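(* Let $K$ be a field of characteristic $0$, $n\ge 2$, $P_0=K[x_1,\dots,x_n]$, $P=P_0[y_1,\dots,y_n]$ bigraded by $\deg x_i=(1,0)$, $\deg y_i=(0,1)$, and $P_+=(y_1,\dots,y_n)$. Let $r\ge 1$ be an integer and, for $\lambda\in K^n$, let $f_\lambda=\sum_{i=1}^n\lambda_i x_iy_i$. Then there exists a nonempty Zariski open subset $V\subset K^n$ such that for all $\lambda\in V$ and all $j\le -n$ the graded $P_0$-module $H^{n-1}_{P_+}(P/f_\lambda^rP)_j$ has a linear resolution.
   Context: For a bigraded $P$-module $N$, $N_j=\bigoplus_i N_{(i,j)}$ is a graded $P_0$-module with $(N_j)_i=N_{(i,j)}$. $H^{n-1}_{P_+}$ is local cohomology with its natural bigrading. A finitely generated graded $P_0$-module has a linear resolution if for some integer $d$ its minimal graded free resolution has $i$-th module of the form $P_0(-d-i)^{b_i}$ for all $i$. *)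

(* Defs.v *)
From HB Require Import structures.
From mathcomp Require Import all_boot all_order all_algebra.
From mathcomp Require Import boolp classical_sets.
From mathcomp Require Export mpoly.
From mathcomp Require Import zify ring.

Set Implicit Arguments.
Unset Strict Implicit.
Unset Printing Implicit Defensive.

Import Order.TTheory GRing.Theory Num.Theory.
Local Open Scope ring_scope.
Local Open Scope quotient_scope.

Section QuotientModule.
Variables (R : comNzRingType) (V : lmodType R) (W : submodClosed V).

(* [submodClosed] does not by itself give the [zmodClosed] that
   [Quotient.quot] expects. *)
Definition submod_pred : {pred V} := W.
Fact submod_pred_closed : submod_closed submod_pred.
Proof. exact: submodClosedP. Qed.
HB.instance Definition _ :=
  GRing.isSubmodClosed.Build R V submod_pred submod_pred_closed.

Definition quotmod : Type := Quotient.quot submod_pred.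
HB.instance Definition _ := GRing.Zmodule.on quotmod.

Definition qclass (v : V) : quotmod := \pi_(Quotient.quot submod_pred) v.

Lemma qclassP u v : reflect (qclass u = qclass v) (u - v \in W).
Proof. by rewrite -[_ \in W]/(_ \in submod_pred) Quotient.idealrBE; apply: eqP. Qed.

Lemma qclass_surj (x : quotmod) : exists v, x = qclass v.
Proof. by exists (repr x); rewrite /qclass reprK. Qed.

Lemma qclassD u v : qclass (u + v) = qclass u + qclass v.
Proof. by rewrite /qclass !piE. Qed.

Definition qscale (a : R) (x : quotmod) : quotmod := qclass (a *: repr x).

Lemma qscaleE a v : qscale a (qclass v) = qclass (a *: v).
Proof.
apply/qclassP; rewrite -scalerBr rpredZ //.
by apply/qclassP; rewrite /qclass reprK.
Qed.

Fact qscaleA a b x : qscale a (qscale b x) = qscale (a * b) x.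
Proof. by have [v ->] := qclass_surj x; rewrite !qscaleE scalerA. Qed.
Fact qscale1 : left_id 1 qscale.
Proof. by move=> x; have [v ->] := qclass_surj x; rewrite qscaleE scale1r. Qed.
Fact qscaleDr : right_distributive qscale +%R.
Proof.
move=> a x y; have [u ->] := qclass_surj x; have [v ->] := qclass_surj y.
by rewrite -qclassD !qscaleE scalerDr qclassD.
Qed.
Fact qscaleDl x : {morph qscale^~ x : a b / a + b}.
Proof.
by move=> a b; have [v ->] := qclass_surj x; rewrite !qscaleE scalerDl qclassD.
Qed.
HB.instance Definition _ :=
  GRing.Zmodule_isLmodule.Build R quotmod qscaleA qscale1 qscaleDr qscaleDl.

End QuotientModule.

(* The localization M_s = M[1/s]: fractions m / s^a encoded as (m, a), modulo
   m / s^a = m' / s^a' iff s^(c + a') m = s^(c + a) m' for some c. *)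
Section Localization.
Variables (R : comNzRingType) (M : lmodType R) (s : R).

Definition fraceq (x y : M * nat) : bool :=
  `[< exists c, s ^+ (c + y.2) *: x.1 = s ^+ (c + x.2) *: y.1 >].

Fact fraceq_equiv : equiv_class_of fraceq.
Proof.
split=> [x|x y|y x z].
- by apply/asboolP; exists 0%N.
- by apply/asboolP/asboolP => -[c e]; exists c; rewrite e.
move=> /asboolP[c e1] /asboolP[c' e2]; apply/asboolP.
exists (c + c' + y.2)%N.
have -> : (c + c' + y.2 + z.2 = (c' + z.2) + (c + y.2))%N by lia.
rewrite exprD -scalerA e1 scalerA mulrC -scalerA e2 scalerA -exprD.
by congr (_ ^+ _ *: _); lia.
Qed.
Canonical fraceq_rel := EquivRelPack fraceq_equiv.
Definition loc : Type := {eq_quot fraceq}.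
HB.instance Definition _ := Choice.on loc.

Definition frac (m : M) (a : nat) : loc := \pi_({eq_quot fraceq}) (m, a).

Lemma fracP m a m' a' :
  frac m a = frac m' a' <->
  exists c, s ^+ (c + a') *: m = s ^+ (c + a) *: m'.
Proof.
split=> [/eqP|h]; first by rewrite eqmodE => /asboolP.
by apply/eqP; rewrite eqmodE; apply/asboolP.
Qed.

Lemma frac_surj (x : loc) : exists m a, x = frac m a.
Proof.
by exists (repr x).1, (repr x).2; rewrite /frac -surjective_pairing reprK.
Qed.

Lemma frac_repr m a : frac (repr (frac m a)).1 (repr (frac m a)).2 = frac m a.
Proof. by rewrite {1}/frac -surjective_pairing reprK. Qed.

Definition loc0 : loc := frac 0 0.
Definition locN (x : loc) : loc := frac (- (repr x).1) (repr x).2.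
Definition locD (x y : loc) : loc :=
  frac (s ^+ (repr y).2 *: (repr x).1 + s ^+ (repr x).2 *: (repr y).1)
       ((repr x).2 + (repr y).2).
Definition locZ (r : R) (x : loc) : loc := frac (r *: (repr x).1) (repr x).2.

Lemma locNE m a : locN (frac m a) = frac (- m) a.
Proof.
have /fracP[c e] := frac_repr m a.
by apply/fracP; exists c; rewrite !scalerN e.
Qed.

Lemma locZE r m a : locZ r (frac m a) = frac (r *: m) a.
Proof.
have /fracP[c e] := frac_repr m a.
by apply/fracP; exists c; rewrite !scalerA ![_ * r]mulrC -!scalerA e.
Qed.

Lemma locDE m a m' a' :
  locD (frac m a) (frac m' a') = frac (s ^+ a' *: m + s ^+ a *: m') (a + a').
Proof.
rewrite /locD; have /fracP[c e] := frac_repr m a.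
have /fracP[c' e'] := frac_repr m' a'.
move: (repr (frac m a)) (repr (frac m' a')) e e' => [u p] [u' p'] /= e e'.
apply/fracP; exists (c + c')%N; rewrite !scalerDr !scalerA -!exprD.
congr (_ + _).
  have -> : (c + c' + (a + a') + p' = (c' + a' + p') + (c + a))%N by lia.
  rewrite exprD -scalerA e scalerA -exprD.
  by congr (_ ^+ _ *: _); lia.
have -> : (c + c' + (a + a') + p = (c + a + p) + (c' + a'))%N by lia.
rewrite exprD -scalerA e' scalerA -exprD.
by congr (_ ^+ _ *: _); lia.
Qed.

Lemma frac_same m m' a : locD (frac m a) (frac m' a) = frac (m + m') a.
Proof.
rewrite locDE; apply/fracP; exists 0%N.
by rewrite -scalerDr scalerA -!exprD; congr (_ ^+ _ *: _); lia.
Qed.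

Fact locDA : associative locD.
Proof.
move=> x y z; have [m [a ->]] := frac_surj x; have [m' [a' ->]] := frac_surj y.
have [m2 [a2 ->]] := frac_surj z; rewrite !locDE; apply/fracP; exists 0%N.
rewrite !scalerDr !scalerA -!exprD addrA; congr (_ + _ + _);
  by congr (_ ^+ _ *: _); lia.
Qed.
Fact locDC : commutative locD.
Proof.
move=> x y; have [m [a ->]] := frac_surj x; have [m' [a' ->]] := frac_surj y.
by rewrite !locDE addrC addnC.
Qed.
Fact locD0 : left_id loc0 locD.
Proof.
move=> x; have [m [a ->]] := frac_surj x.
by rewrite locDE scaler0 add0r expr0 scale1r.
Qed.
Fact locDN : left_inverse loc0 locN locD.
Proof.
move=> x; have [m [a ->]] := frac_surj x; rewrite locNE frac_same addNr.
by apply/fracP; exists 0%N; rewrite !scaler0.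
Qed.
HB.instance Definition _ := GRing.isZmodule.Build loc locDA locDC locD0 locDN.

Fact locZA a b x : locZ a (locZ b x) = locZ (a * b) x.
Proof. by have [m [k ->]] := frac_surj x; rewrite !locZE scalerA. Qed.
Fact locZ1 : left_id 1 locZ.
Proof. by move=> x; have [m [k ->]] := frac_surj x; rewrite locZE scale1r. Qed.
Fact locZDr : right_distributive locZ +%R.
Proof.
move=> r x y; have [m [a ->]] := frac_surj x; have [m' [a' ->]] := frac_surj y.
have -> : frac m a + frac m' a' = locD (frac m a) (frac m' a') by [].
have eD u v : (u + v : loc) = locD u v by [].
rewrite eD locDE !locZE locDE scalerDr !scalerA.
by rewrite [r * s ^+ a']mulrC [r * s ^+ a]mulrC.
Qed.
Fact locZDl x : {morph locZ^~ x : a b / a + b}.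
Proof.
move=> a b; have [m [k ->]] := frac_surj x.
have eD u v : (u + v : loc) = locD u v by [].
by rewrite eD !locZE frac_same scalerDl.
Qed.
HB.instance Definition _ :=
  GRing.Zmodule_isLmodule.Build R loc locZA locZ1 locZDr locZDl.

End Localization.

(* The canonical map M_s -> M_s', m / s^a |-> u^a m / s'^a, for s' = u * s. *)
Section LocalizationMap.
Variables (R : comNzRingType) (M : lmodType R) (s s' u : R).
Hypothesis s'E : s' = u * s.

Definition locmap (x : loc M s) : loc M s' :=
  frac s' (u ^+ (repr x).2 *: (repr x).1) (repr x).2.

Lemma locmapE m a : locmap (frac s m a) = frac s' (u ^+ a *: m) a.
Proof.
have /fracP[c e] := frac_repr s m a; rewrite /locmap.
move: (repr (frac s m a)) e => [m1 a1] /= e.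
apply/fracP; exists c; rewrite !scalerA s'E !exprMn.
rewrite -!mulrA ![_ * u ^+ _]mulrC !mulrA -!exprD -!scalerA e !scalerA.
by congr (_ * _ *: _); congr (_ ^+ _); lia.
Qed.

Fact locmap_is_linear : linear locmap.
Proof.
move=> r x y; have [m [a ->]] := frac_surj x; have [m' [a' ->]] := frac_surj y.
have ZE (t : R) k n b : k *: frac t n b = frac t (k *: n) b :> loc M t.
  exact: locZE.
have DE (t : R) n b n' b' : frac t n b + frac t n' b' =
    frac t (t ^+ b' *: n + t ^+ b *: n') (b + b') :> loc M t by exact: locDE.
rewrite ZE DE !locmapE ZE DE; apply/fracP; exists 0%N; congr (_ *: _).
rewrite !scalerDr !scalerA s'E !exprMn exprD.
by congr (_ *: _ + _ *: _); ring.
Qed.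

End LocalizationMap.

(* The Cech complex of M on y_0, ..., y_(m-1): its term of degree k is the
   product of the M_(y_S), y_S = prod_(t in S) y_t, over the S with #|S| = k.
   All degrees are put together in the module [cech]; [cochain k] singles out
   degree k. *)
Section Cech.
Variables (R : comNzRingType) (m : nat) (M : lmodType R) (y : 'I_m -> R).

Definition yprod (S : {set 'I_m}) : R := \prod_(t in S) y t.

Definition cech : Type := forall S : {set 'I_m}, loc M (yprod S).
HB.instance Definition _ := Choice.on cech.

Definition cech0 : cech := fun _ => 0.
Definition cechN (c : cech) : cech := fun S => - c S.
Definition cechD (c c' : cech) : cech := fun S => c S + c' S.
Definition cechZ (a : R) (c : cech) : cech := fun S => a *: c S.

Fact cechDA : associative cechD.
Proof. by move=> a b c; apply: functional_extensionality_dep => S; apply: addrA. Qed.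
Fact cechDC : commutative cechD.
Proof. by move=> a b; apply: functional_extensionality_dep => S; apply: addrC. Qed.
Fact cechD0 : left_id cech0 cechD.
Proof. by move=> a; apply: functional_extensionality_dep => S; apply: add0r. Qed.
Fact cechDN : left_inverse cech0 cechN cechD.
Proof. by move=> a; apply: functional_extensionality_dep => S; apply: addNr. Qed.
HB.instance Definition _ :=
  GRing.isZmodule.Build cech cechDA cechDC cechD0 cechDN.

Fact cechZA a b x : cechZ a (cechZ b x) = cechZ (a * b) x.
Proof. by apply: functional_extensionality_dep => S; apply: scalerA. Qed.
Fact cechZ1 : left_id 1 cechZ.
Proof. by move=> a; apply: functional_extensionality_dep => S; apply: scale1r. Qed.
Fact cechZDr : right_distributive cechZ +%R.
Proof. by move=> a b c; apply: functional_extensionality_dep => S; apply: scalerDr. Qed.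
Fact cechZDl x : {morph cechZ^~ x : a b / a + b}.
Proof. by move=> a b; apply: functional_extensionality_dep => S; apply: scalerDl. Qed.
HB.instance Definition _ :=
  GRing.Zmodule_isLmodule.Build R cech cechZA cechZ1 cechZDr cechZDl.

Definition cochain (k : nat) (c : cech) : Prop :=
  forall S : {set 'I_m}, #|S| != k -> c S = 0.

Definition cechd (c : cech) : cech := fun T =>
  \sum_(t in T) (-1) ^+ #|[set u in T | (u < t)%N]| *:
    locmap (yprod T) (y t) (c (T :\ t)).

Lemma yprodD1 (T : {set 'I_m}) t : t \in T -> yprod T = y t * yprod (T :\ t).
Proof. by move=> tT; rewrite /yprod (big_setD1 t). Qed.

Fact cechd_is_linear : linear cechd.
Proof.
move=> a c c'; apply: functional_extensionality_dep => T.
have -> : (a *: cechd c + cechd c') T = a *: cechd c T + cechd c' T by [].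
rewrite /cechd scaler_sumr -big_split /=; apply: eq_bigr => t tT.
have -> : (a *: c + c') (T :\ t) = a *: c (T :\ t) + c' (T :\ t) by [].
rewrite (locmap_is_linear (yprodD1 tT)) scalerDr !scalerA.
by rewrite [_ * a]mulrC.
Qed.
HB.instance Definition _ :=
  GRing.isLinear.Build R cech cech _ cechd cechd_is_linear.

Section Cohomology.
Variable k : nat.

Definition cocycle_pred : {pred cech} :=
  fun c => `[< cochain k c /\ cechd c = 0 >].

Fact cocycle_pred_closed : submod_closed cocycle_pred.
Proof.
split; first by apply/asboolP; split => [S _|]; rewrite ?raddf0.
move=> a c c' /asboolP[hc dc] /asboolP[hc' dc']; apply/asboolP; split.
  move=> S kS.
  have -> : (a *: c + c') S = a *: c S + c' S by [].
  by rewrite hc // hc' // scaler0 addr0.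
by rewrite linearP /= dc dc' scaler0 addr0.
Qed.
HB.instance Definition _ :=
  GRing.isSubmodClosed.Build R cech cocycle_pred cocycle_pred_closed.

Definition cocycle : Type := {c : cech | c \in cocycle_pred}.
HB.instance Definition _ := SubChoice.on cocycle.
HB.instance Definition _ := [SubChoice_isSubLmodule of cocycle by <:].

(* [#|S|.+1 != k] says that b is a cochain of degree k - 1; for k = 0 it forces
   b = 0. *)
Definition coboundary_pred : {pred cocycle} :=
  fun z => `[< exists b : cech,
    (forall S : {set 'I_m}, #|S|.+1 != k -> b S = 0) /\ cechd b = val z >].

Fact coboundary_pred_closed : submod_closed coboundary_pred.
Proof.
split; first by apply/asboolP; exists 0; split => [S _|]; rewrite ?raddf0.
move=> a z z' /asboolP[b [hb db]] /asboolP[b' [hb' db']]; apply/asboolP.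
exists (a *: b + b'); split.
  move=> S kS.
  have -> : (a *: b + b') S = a *: b S + b' S by [].
  by rewrite hb // hb' // scaler0 addr0.
by rewrite !linearP /= db db'.
Qed.
HB.instance Definition _ :=
  GRing.isSubmodClosed.Build R cocycle coboundary_pred coboundary_pred_closed.

(* H^k_I(M) for I = (y_0, ..., y_(m-1)) *)
Definition local_cohomology : lmodType R := quotmod coboundary_pred.

End Cohomology.
End Cech.

Arguments cocycle {R m} M y k.
Arguments coboundary_pred {R m} M y k : rename.
Arguments local_cohomology {R m} M y k.

Section Graded.
Variables (K : fieldType) (n : nat).
Local Notation P0 := {mpoly K[n]}.

Definition xhomog (e : int) (p : P0) : Prop :=
  {in msupp p, forall m, (mdeg m)%:Z = e}.

(* A graded P0-module, given as the submodule \bigoplus_e gcomp e of an ambient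
   P0-module. *)
Record graded_module := GradedModule {
  gambient : lmodType P0;
  gcomp : int -> set gambient
}.
Arguments gcomp : clear implicits.

(* Graded free resolutions
     ... -> F_2 -> F_1 -> F_0 -> N -> 0,  F_i = \bigoplus_k P0(- shift i k).
   F_i is the module of row vectors of length rk i, its k-th basis vector having
   degree shift i k; the differentials are matrices acting on the right, and the
   augmentation sends the k-th basis vector of F_0 to [aug k]. *)
Record graded_free_resolution (N : graded_module) := GradedFreeResolution {
  rk : nat -> nat;
  shift : forall i, 'I_(rk i) -> int;
  diff : forall i, 'M[P0]_(rk i.+1, rk i);
  aug : 'I_(rk 0) -> gambient N;
  diff_graded : forall i k l,
    xhomog (@shift i.+1 k - @shift i l) (diff i k l);
  aug_graded : forall k, gcomp N (@shift 0 k) (aug k);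
  res_exact : forall i (u : 'rV[P0]_(rk i.+1)),
    u *m diff i = 0 <-> exists w : 'rV[P0]_(rk i.+2), u = w *m diff i.+1;
  aug_exact : forall u : 'rV[P0]_(rk 0),
    \sum_k u 0 k *: aug k = 0 <-> exists w : 'rV[P0]_(rk 1), u = w *m diff 0;
  aug_onto : forall e v, gcomp N e v ->
    exists u : 'rV[P0]_(rk 0), v = \sum_k u 0 k *: aug k
}.

(* The image of each F_(i+1) -> F_i lies in (x_1, ..., x_n) F_i. *)
Definition minimal_resolution N (F : graded_free_resolution N) : Prop :=
  forall i k l, (diff F i k l)@_0%MM = 0.

Definition has_linear_resolution (N : graded_module) : Prop :=
  exists (d : int) (F : graded_free_resolution N),
    minimal_resolution F /\ forall i k, @shift N F i k = d + i%:Z.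

Definition zariski_open (V : set 'rV[K]_n) : Prop :=
  exists I : set P0, forall v, V v <-> exists2 p, I p & p.@[v 0] != 0.

End Graded.

Section Bigraded.
Variables (K : fieldType) (n : nat).
Local Notation P0 := {mpoly K[n]}.
Local Notation P := {mpoly {mpoly K[n]}[n]}.

Definition bihomog (i j : int) (p : P) : Prop :=
  {in msupp p, forall m, (mdeg m)%:Z = j /\ xhomog i p@_m}.

Definition restr (M : lmodType P) : Type := M.

Section Restr.
Variable M : lmodType P.
HB.instance Definition _ := GRing.Zmodule.on (restr M).
Definition restr_scale (a : P0) (v : restr M) : restr M :=
  (a%:MP : P) *: (v : M).
Fact restr_scaleA a b v :
  restr_scale a (restr_scale b v) = restr_scale (a * b) v.
Proof. by rewrite /restr_scale scalerA -mpolyCM. Qed.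
Fact restr_scale1 : left_id 1 restr_scale.
Proof. by move=> v; rewrite /restr_scale mpolyC1 scale1r. Qed.
Fact restr_scaleDr : right_distributive restr_scale +%R.
Proof. by move=> a u v; apply: scalerDr. Qed.
Fact restr_scaleDl v : {morph restr_scale^~ v : a b / a + b}.
Proof. by move=> a b; rewrite /restr_scale mpolyCD scalerDl. Qed.
HB.instance Definition _ := GRing.Zmodule_isLmodule.Build P0 (restr M)
  restr_scaleA restr_scale1 restr_scaleDr restr_scaleDl.
End Restr.

Definition yvar (t : 'I_n) : P := 'X_t.

(* H^k_(P_+)(M)_j as a graded P0-module, for a P-module M with bigrading G.
   The bigrading is the one induced by the Cech complex: for m of bidegree
   (i, j'), the fraction m / y_S^a has bidegree (i, j' - a #|S|). *)
Definition lc_comp (M : lmodType P) (G : int -> int -> set M) (k : nat)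
    (i j : int) : set (local_cohomology M yvar k) :=
  [set h | exists z : cocycle M yvar k,
     (forall S : {set 'I_n}, exists (m : M) (a : nat),
        G i (j + (a * #|S|)%:Z) m /\ val z S = frac (yprod yvar S) m a) /\
     h = qclass (coboundary_pred M yvar k) z]%classic.

Definition lc_part (M : lmodType P) (G : int -> int -> set M) (k : nat)
    (j : int) : graded_module K n :=
  @GradedModule K n (restr (local_cohomology M yvar k))
    (fun i => @lc_comp M G k i j).

Section Hypersurface.
Variable g : P.

Definition principal : {pred P^o} := fun p => `[< exists q : P, p = q * g >].

Fact principal_closed : submod_closed principal.
Proof.
split; first by apply/asboolP; exists 0; rewrite mul0r.
move=> a p p' /asboolP[q ->] /asboolP[q' ->]; apply/asboolP.
by exists (a * q + q'); rewrite mulrDl -mulrA.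
Qed.
HB.instance Definition _ :=
  GRing.isSubmodClosed.Build P P^o principal principal_closed.

Definition hypersurface : lmodType P := quotmod principal.

Definition hypersurface_comp (i j : int) : set hypersurface :=
  [set x | exists2 p : P, bihomog i j p & x = qclass principal p]%classic.

End Hypersurface.

Definition flam (lam : 'rV[K]_n) : P :=
  \sum_(i < n) (lam 0 i *: 'X_i : P0) *: ('X_i : P).

End Bigraded.

(* Main.v *)
Require Import Defs.
From HB Require Import structures.
From mathcomp Require Import all_boot all_order all_algebra.
From mathcomp Require Import boolp classical_sets functions.
From mathcomp Require Import ssrcomplements mpoly zify ring.

(** Why the theorem is true.  Put [d = - j - n >= 0] and [g = f_lambda ^ r].
    The local cohomology of [P] vanishes below degree [n], so the sequence
    [0 -> P(-r,-r) -> P -> P/g -> 0] identifies [H^(n-1)(P/g)_j] with the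
    kernel of multiplication by [g] from [H^n(P)_(j-r)] to [H^n(P)_j].  These
    two modules are free over [P0], on the inverse monomials [y ^ (- m - 1)]
    with [mdeg m = d + r] and [mdeg m = d] respectively, and [g] acts on
    coefficient functions [m |-> v m] by contraction ([contr]).

    Take for [V] the set of all [lambda] without zero coordinate.  Read in
    divided powers of variables [z_i], contraction with [f_lambda] is the
    polarization operator [E = sum_i lambda_i x_i d/dz_i].  Together with
    [F = sum_i lambda_i^-1 z_i d/dx_i] it is an sl2-triple whose weight in
    bidegree [(a, b)] is [a - b] ([polarization_sl2]).  In characteristic [0]
    the hard Lefschetz property of such triples ([sl2_inj], [sl2_surj]) says
    that the kernel of [E ^ r] vanishes in [x]-degrees at most [d], and that
    the cokernel of [E ^ r] vanishes in [x]-degrees at least [d + r].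

    A graded module that vanishes in large degrees has no Koszul homology
    there, hence has bounded regularity, and each passage to syzygies raises
    the bound by one.  The kernel is a second syzygy of the cokernel; it starts
    exactly where the bound on its regularity ends ([contr_kernel_linear]).  A
    module with this property is generated by its lowest degree, and its
    syzygies over a [K]-basis of that degree have the property again, in degree
    one.  Iteration gives the linear resolution ([linear_module_resolution]).

    The identification of [H^(n-1)(P/g)_j] with the kernel is made on
    representatives.  An [(n-1)]-cocycle has components [w T / y_T ^ N] with one
    exponent [N], and the cocycle condition, after enlarging [N], reads
    [sum +- y_t ^ N w T = q g] in [P].  The element of the kernel is the class
    of [q / (y_1 ... y_n) ^ N], recorded by the coefficients [resid N q].  It
    vanishes exactly on coboundaries ([represents_coboundary],
    [coboundary_represents]) because the Koszul complex on [y_1 ^ N, ...,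
    y_n ^ N] is exact below the top; the same theorem [koszul_exact], with
    [N = 1], serves for the variables [x_i] in the regularity argument. *)

Set Implicit Arguments.
Unset Strict Implicit.
Unset Printing Implicit Defensive.

Import Order.TTheory GRing.Theory Num.Theory.
Local Open Scope ring_scope.

(** * The Koszul cochain complex and its exactness on powers of the variables *)

Section KoszulDifferential.
Variables (n : nat) (R : comNzRingType) (V : lmodType R).
Implicit Types (T : {set 'I_n}) (s t : 'I_n).

Definition spos T t : nat := #|[set u in T | (u < t)%N]|.

(** The signs are those of [cechd]: a Cech cochain with components
    [w T / y_T ^ N] is sent by the Cech differential to the one with numerators
    [kosd (fun t => y_t ^ N) w]. *)
Definition kosd (x : 'I_n -> R) (w : {set 'I_n} -> V) T : V :=
  \sum_(t in T) (-1) ^+ spos T t *: (x t *: w (T :\ t)).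

Lemma sposD1 T s t : t \in T -> spos T s = (spos (T :\ t) s + (t < s)%N)%N.
Proof.
move=> tT; rewrite /spos (cardsD1 t) !inE tT /= addnC; congr (_ + _)%N.
by apply: eq_card => u; rewrite !inE andbA.
Qed.

Lemma spos_anti T s t : s != t -> s \in T -> t \in T ->
  (-1) ^+ (spos T t + spos (T :\ t) s) =
  - (-1) ^+ (spos T s + spos (T :\ s) t) :> R.
Proof.
move=> st sT tT; rewrite (sposD1 t sT) (sposD1 s tT) !exprD.
case: ltngtP => [_|_|/val_inj e]; last by rewrite e eqxx in st.
all: by rewrite !(expr0, expr1); ring.
Qed.

(** Splitting the pairs into [s < t] and [t < s] instead of using [2 S = 0]
    keeps the statement valid in every characteristic. *)
Lemma sum_antisym T (F : 'I_n -> 'I_n -> V) :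
  (forall s t, s != t -> s \in T -> t \in T -> F t s = - F s t) ->
  \sum_(t in T) \sum_(s in T :\ t) F t s = 0.
Proof.
move=> HF.
pose G (b : 'I_n -> 'I_n -> bool) :=
  \sum_(t in T) \sum_(s in T) if b t s then F t s else 0.
have -> : \sum_(t in T) \sum_(s in T :\ t) F t s =
    G (fun t s => (s < t)%N) + G (fun t s => (t < s)%N).
  rewrite /G -big_split /=; apply: eq_bigr => t tT; rewrite -big_split /=.
  rewrite (big_setD1 t tT) /= ltnn addr0 add0r; apply: eq_bigr => s.
  rewrite !inE => /andP[st _]; case: ltngtP => [||/val_inj e].
  - by rewrite addr0.
  - by rewrite add0r.
  - by rewrite e eqxx in st.
rewrite [X in X + _]/G exchange_big /= /G -big_split /= big1 // => t tT.
rewrite -big_split /= big1 // => s sT.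
case: ifP => [ts|_]; last by rewrite addr0.
by rewrite (HF t s) ?addNr // -val_eqE ltn_eqF.
Qed.

Lemma kosdK x w : kosd x (kosd x w) =1 fun _ => 0.
Proof.
move=> T; rewrite /kosd.
under eq_bigr => t tT do
  rewrite !scaler_sumr.
apply: sum_antisym => s t st sT tT.
rewrite !scalerA -scaleNr; congr (_ *: w _); last first.
  by apply/finset.setP => u; rewrite !inE andbCA.
set a := x t; set b := x s.
have -> : (-1) ^+ spos T t * a * (-1) ^+ spos (T :\ t) s * b =
   (-1) ^+ (spos T t + spos (T :\ t) s) * (a * b) by rewrite exprD; ring.
by rewrite (spos_anti st) // exprD; ring.
Qed.

Lemma eq_kosd x w w' : w =1 w' -> kosd x w =1 kosd x w'.
Proof. by move=> e T; apply: eq_bigr => t _; rewrite e. Qed.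

Lemma kosd0 x w : w =1 (fun=> 0) -> kosd x w =1 fun _ => 0.
Proof. by move=> e T; rewrite /kosd big1 // => t _; rewrite e !scaler0. Qed.

Lemma kosdD x w w' :
  kosd x (fun T => w T + w' T) =1 fun T => kosd x w T + kosd x w' T.
Proof.
by move=> T; rewrite /kosd -big_split /=; apply: eq_bigr => t _; rewrite !scalerDr.
Qed.

Lemma kosdB x w w' :
  kosd x (fun T => w T - w' T) =1 fun T => kosd x w T - kosd x w' T.
Proof.
move=> T; rewrite /kosd -sumrB; apply: eq_bigr => t _.
by rewrite !scalerBr.
Qed.

End KoszulDifferential.

Lemma kosd_linear n (R : comNzRingType) (V V' : lmodType R) (h : {linear V -> V'})
    (x : 'I_n -> R) w : kosd x (fun T => h (w T)) =1 fun T => h (kosd x w T).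
Proof.
move=> T; rewrite /kosd linear_sum; apply: eq_bigr => t _.
by rewrite !(linearZZ h).
Qed.

Section KoszulExact.
Variables (n : nat) (A : comNzRingType) (N : nat).
Local Notation S := {mpoly A[n]}.
Implicit Types (T : {set 'I_n}) (a : 'X_{1..n}).

Definition ypow (t : 'I_n) : S := 'X_t ^+ N.

Lemma mcoeff_ypowM t (p : S) a :
  (ypow t * p)@_a = if (N <= a t)%N then p@_(a - U_(t) *+ N)%MM else 0.
Proof.
rewrite /ypow mpolyXn mulrC; case: ifPn => Na.
  have {1}-> : (a = U_(t) *+ N + (a - U_(t) *+ N))%MM.
    rewrite addmC submK //; apply/mnm_lepP => i; rewrite mulmnE mnm1E.
    by case: eqP => [<-|] //=; rewrite mul1n.
  by rewrite mcoeffMX.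
apply/eqP; rewrite mcoeff_eq0; apply/negP => /msuppM_le /allpairsP[[b c] /= [_]].
rewrite msuppX inE => /eqP -> e; move/negP: Na; apply.
by rewrite e mnmDE mulmnE mnm1E eqxx mul1n leq_addl.
Qed.

Lemma mcoeff_kosd (w : {set 'I_n} -> S^o) T a :
  (kosd ypow w T : S)@_a = \sum_(t in T | (N <= a t)%N)
     (-1) ^+ spos T t * (w (T :\ t) : S)@_(a - U_(t) *+ N)%MM.
Proof.
rewrite /kosd raddf_sum big_mkcondr /=; apply: eq_bigr => t _.
have -> : (-1) ^+ spos T t *: (ypow t *: w (T :\ t)) =
   ((-1) ^+ spos T t)%:MP * (ypow t * (w (T :\ t) : S)).
  by rewrite rmorphXn rmorphN1.
by rewrite mcoeffCM mcoeff_ypowM; case: ifP => // _; rewrite mulr0.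
Qed.

(** The complex is multigraded: the monomial [a] at [T] lies in the same
    multidegree as the monomial [a - N U_(t)] at [T :\ t].  In one multidegree it
    is the augmented cochain complex of the simplex on the vertices [u] with
    [u \notin T] or [N <= a u], a set that the differential does not change
    ([hpick_step]); a vertex chosen from this set contracts it. *)
Definition hpick T a : option 'I_n := [pick u | (u \notin T) || (N <= a u)%N].

Definition hcoeff (w : {set 'I_n} -> S) T a : A :=
  if hpick T a is Some s then
    if s \notin T then
      (-1) ^+ spos (s |: T) s * (w (s |: T))@_(a + U_(s) *+ N)%MM
    else 0
  else 0.

Lemma hpick_step T t a : t \in T -> (N <= a t)%N ->
  hpick (T :\ t) (a - U_(t) *+ N)%MM = hpick T a.
Proof.
move=> tT Na; apply: eq_pick => u /=; rewrite !inE negb_and negbK.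
rewrite mnmBE mulmnE mnm1E; case: (eqVneq u t) => [->|ut]; first by rewrite Na orbT.
by rewrite /= mul0n subn0.
Qed.

(** The hypothesis on monomials says that only multidegrees with a nonempty
    simplex occur.  The second conclusion describes every coefficient of the
    primitive as a signed coefficient of [w], so that homogeneity passes from
    [w] to the primitive. *)
Theorem koszul_exact (w : {set 'I_n} -> S^o) :
  (forall T a, (w T : S)@_a != 0 -> exists s, (s \notin T) || (N <= a s)%N) ->
  kosd ypow w =1 (fun=> 0) ->
  exists w' : {set 'I_n} -> S^o, kosd ypow w' =1 w /\
    forall T a, (w' T : S)@_a != 0 -> exists s b, s \notin T /\
      (w' T : S)@_a = (-1) ^+ b * (w (s |: T) : S)@_(a + U_(s) *+ N)%MM.
Proof.
move=> Hw dw.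
pose B := (\max_(T : {set 'I_n}) msize (w T : S)).+1.
pose h T : S := \sum_(a : 'X_{1..n < B}) hcoeff w T a *: 'X_[a].
have hE T a : (h T)@_a = hcoeff w T a.
  have [aB|Ba] := ltnP (mdeg a) B; first exact: mcoeff_mpoly.
  have -> : (h T)@_a = 0.
    rewrite /h raddf_sum /= big1 // => b _; rewrite mcoeffZ mcoeffX.
    by case: eqP => [e|_]; rewrite ?mulr0 //; move: (bmdeg b); rewrite e ltnNge Ba.
  rewrite /hcoeff; case: (hpick T a) => // s; case: ifP => // _.
  rewrite memN_msupp_eq0 ?mulr0 //; apply: msize_mdeg_ge.
  rewrite mdegD; apply: leq_trans (leq_addr _ _); apply: leq_trans Ba.
  apply: leq_trans (leqnSn _); exact: leq_bigmax.
exists h; split; last first.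
  move=> T a; rewrite hE /hcoeff; case: (hpick T a) => [s|]; last by rewrite eqxx.
  by case: ifP => [sT _|]; rewrite ?eqxx //; exists s, (spos (s |: T) s).
move=> T; apply/mpolyP => a; rewrite mcoeff_kosd.
under eq_bigr => t /andP[tT Na] do rewrite hE /hcoeff hpick_step //.
case e: (hpick T a) => [s|]; last first.
  rewrite big1 ?mulr0 // => [|t _]; last by rewrite mulr0.
  apply/esym/eqP; apply: contraT => /Hw[s hs].
  by move: e; rewrite /hpick; case: pickP => // /(_ s); rewrite hs.
have hs : (s \notin T) || (N <= a s)%N.
  by move: e; rewrite /hpick; case: pickP => // u hu [<-].
have [sT|sT] := boolP (s \in T).
  (* As the chosen vertex s lies in T, h (T :\ t) vanishes unless t = s. *)
  rewrite sT /= in hs.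
  rewrite (bigD1 s) /=; last by rewrite sT.
  rewrite !inE eqxx /= finset.setD1K // signrMK.
  rewrite submK; last first.
    apply/mnm_lepP => i; rewrite mulmnE mnm1E.
    by case: eqP => [<-|] //=; rewrite mul1n.
  rewrite big1 ?addr0 // => t /andP[_ ts].
  by rewrite !inE eq_sym (negbTE ts) sT mulr0.
(* As s lies outside T, the cocycle condition at s |: T expresses w T through
   the other faces of s |: T. *)
have := dw (s |: T) => /(congr1 (mcoeff (a + U_(s) *+ N)%MM)).
rewrite mcoeff_kosd mcoeff0 (bigD1 s) /=; last first.
  by rewrite !inE eqxx /= mnmDE mulmnE mnm1E eqxx mul1n leq_addl.
rewrite finset.setU1K // addmK => /eqP; rewrite addr_eq0 => /eqP eq_s.
set c := (-1) ^+ spos (s |: T) s in eq_s *.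
have c2 : c * c = 1 by rewrite -expr2 sqrr_sign.
have -> : (w T)@_a = c * (c * (w T)@_a) by rewrite signrMK.
rewrite eq_s mulrN mulr_sumr -sumrN.
apply: eq_big => [t|t /andP[tT Nt]].
  rewrite !inE mnmDE mulmnE mnm1E.
  case: (eqVneq t s) => [->|ts] /=; first by rewrite (negbTE sT) ?eqxx ?andbF.
  by rewrite mul0n addn0 andbT.
have ts : t != s by apply: contraNneq sT => <-.
rewrite !inE negb_and (negbTE sT) orbT.
have -> : s |: T :\ t = (s |: T) :\ t.
  by apply/setP => u; rewrite !inE; case: (eqVneq u s) => [->|] //=; rewrite eq_sym ts.
have -> : (a - U_(t) *+ N + U_(s) *+ N = a + U_(s) *+ N - U_(t) *+ N)%MM.
  apply/mnmP => i; rewrite !(mnmDE, mnmBE, mulmnE, mnm1E).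
  case: (eqVneq t i) => [<-|] /=; last by rewrite !mul0n !subn0.
  by rewrite eq_sym (negbTE ts) mul0n !addn0.
rewrite !mulrA -[RHS]mulNr; congr (_ * _).
have := @spos_anti n A (s |: T) s t _ _ _; rewrite finset.setU1K //.
rewrite eq_sym ts !inE eqxx tT orbT => /(_ isT isT isT).
rewrite addnC [in RHS]addnC !exprD -/c => E.
have E2 : (-1) ^+ spos (s |: T) t * (-1) ^+ spos ((s |: T) :\ t) s =
  - (c * (-1) ^+ spos T t) by rewrite mulrC E mulrC.
have d2 : (-1) ^+ spos ((s |: T) :\ t) s * (-1) ^+ spos ((s |: T) :\ t) s = 1 :> A.
  by rewrite -expr2 sqrr_sign.
set d := (-1) ^+ spos ((s |: T) :\ t) s in E2 d2 *.
set f := (-1) ^+ spos (s |: T) t in E2 *.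
have -> : f = f * d * d by rewrite -mulrA d2 mulr1.
by rewrite E2; ring: c2.
Qed.

End KoszulExact.

(** * Hard Lefschetz for bigraded sl2-triples in characteristic zero *)

Section Sl2.
Variables (K : fieldType) (U : lmodType K).
Hypothesis charK : [pchar K] =i pred0.

Lemma natf_neq0_char0 k : (0 < k)%N -> k%:R != 0 :> K.
Proof. by move=> k0; have /pcharf0P -> := charK; rewrite -lt0n. Qed.

(** [B a b] is the piece of bidegree [(a, b)] and weight [a - b].  The vanishing
    of [E] on [B a 0] and of [F] on [B 0 b] replaces local nilpotence. *)
Record bigraded_sl2 (E F : {linear U -> U}) (B : nat -> nat -> U -> Prop) := {
  sl2_lin : forall a b c u v, B a b u -> B a b v -> B a b (c *: u + v);
  sl2_0 : forall a b, B a b 0;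
  sl2_E : forall a b u, B a b.+1 u -> B a.+1 b (E u);
  sl2_E0 : forall a u, B a 0%N u -> E u = 0;
  sl2_F : forall a b u, B a.+1 b u -> B a b.+1 (F u);
  sl2_F0 : forall b u, B 0%N b u -> F u = 0;
  sl2_comm : forall a b u, B a b u -> E (F u) = F (E u) + (a%:R - b%:R) *: u
}.

Lemma sl2_swap E F B : bigraded_sl2 E F B -> bigraded_sl2 F E (fun a b => B b a).
Proof.
case=> lin B0 hE hE0 hF hF0 comm; split; rewrite /= ?/idfun => //; eauto.
move=> a b u /comm ->; rewrite -addrA -scalerDl addrA subrK subrr.
by rewrite scale0r addr0.
Qed.

Section Theory.
Variables (E F : {linear U -> U}) (B : nat -> nat -> U -> Prop).
Hypothesis sl2B : bigraded_sl2 E F B.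

Lemma sl2_iter a b k u : B a b u ->
  (k <= b)%N -> B (a + k) (b - k) (iter k E u).
Proof.
move=> Bu; elim: k => [|k IH] kb; first by rewrite addn0 subn0.
rewrite addnS iterS; apply: (sl2_E sl2B).
by rewrite subnSK //; apply: IH; apply: ltnW.
Qed.

Lemma sl2_iter_gt a b k u : B a b u -> (b < k)%N -> iter k E u = 0.
Proof.
move=> Bu bk; have [k' ->] : exists k', k = (k' + b.+1)%N.
  by exists (k - b.+1)%N; rewrite subnK.
rewrite iterD iterS.
have := sl2_iter Bu (leqnn b); rewrite subnn => /(sl2_E0 sl2B) ->.
by elim: k' {bk} => //= k' ->; rewrite linear0.
Qed.

Lemma iter_lin k c u v : iter k E (c *: u + v) = c *: iter k E u + iter k E v.
Proof. by elim: k => //= k ->; rewrite linearP. Qed.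

Lemma iter_0 k : iter k E 0 = 0.
Proof. by elim: k => //= k ->; rewrite linear0. Qed.

(** The commutator [[E ^ (k+1), F]] is [k+1] times [E ^ k] times the mean of the
    weights met along the way.  If [k > b] both sides vanish. *)
Lemma sl2_comm_iter a b k u : B a b u ->
  iter k.+1 E (F u) = F (iter k.+1 E u) +
     (k.+1%:R * (a%:R + k%:R - b%:R)) *: iter k E u.
Proof.
move=> Bu; elim: k => [|k IH].
  by rewrite /= mul1r addr0; apply: (sl2_comm sl2B Bu).
rewrite iterS IH linearD linearZ /=.
have [kb|bk] := leqP k.+1 b.
  have := sl2_comm sl2B (sl2_iter Bu kb); rewrite iterS => ->.
  rewrite -addrA -scalerDl; congr (_ + _ *: _).
  rewrite natrD natrB //; ring.
have := sl2_iter_gt Bu bk; rewrite iterS => ->.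
by rewrite !(linear0, scaler0).
Qed.

(** On a lowest weight vector [E ^ j u = 0] forces [E ^ (j-1) u = 0], as the
    commutator multiplies [E ^ (j-1) u] by [j (j - 1 - k)], a nonzero scalar for
    [1 <= j <= k]. *)
Lemma sl2_lowest a k u : B a (a + k) u -> F u = 0 -> iter k E u = 0 -> u = 0.
Proof.
move=> Bu Fu.
have desc j : (j <= k)%N -> iter j E u = 0 -> u = 0; last by apply: (desc k).
elim: j => // j IHj jk Ej; apply: IHj; first exact: ltnW.
have := sl2_comm_iter j Bu; rewrite Ej Fu linear0 iter_0 add0r.
move/esym/eqP; rewrite scaler_eq0 => /orP[|/eqP //].
rewrite mulf_eq0 (negbTE (natf_neq0_char0 _)) //=.
rewrite natrD opprD addrACA subrr add0r -opprB oppr_eq0 -natrB ?(ltnW jk) //.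
by rewrite (negbTE (natf_neq0_char0 _)) // subn_gt0.
Qed.

(** If [E ^ k u = 0] then [E ^ (k+2)] kills [F u], so [F u = 0] by induction on
    [a] and [u] is a lowest weight vector. *)
Lemma sl2_lefschetz_inj a k u : B a (a + k) u -> iter k E u = 0 -> u = 0.
Proof.
elim: a k u => [|a IH] k u Bu Ek; apply: (sl2_lowest Bu _ Ek).
  exact: (sl2_F0 sl2B Bu).
have := sl2_comm_iter k Bu.
rewrite [iter _ _ u]iterS Ek linear0 linear0 scaler0 addr0 => EF.
apply: (IH k.+2); last by rewrite iterS EF linear0.
by rewrite !addnS; apply: (sl2_F sl2B); rewrite -addSn.
Qed.

Lemma sl2_lin0 a b c u : B a b u -> B a b (c *: u).
Proof. by move=> Bu; rewrite -[_ *: _]addr0; apply: (sl2_lin sl2B) => //; apply: (sl2_0 sl2B). Qed.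

End Theory.

(** [E ^ k F ^ k] multiplies a highest weight vector of weight [k] by
    [k! ^ 2]. *)
Lemma sl2_highest E F B a k v : bigraded_sl2 E F B -> B (a + k)%N a v -> E v = 0 ->
  exists2 u, B a (a + k)%N u & iter k E u = v.
Proof.
move=> sl2B Bv Ev; have sl2B' := sl2_swap sl2B.
have [c c0 Ec] : exists2 c : K, c != 0 & iter k E (iter k F v) = c *: v.
  have H j : (j <= k)%N -> exists2 c : K, c != 0 & iter j E (iter j F v) = c *: v.
    elim: j => [|j IH] jk; first by exists 1; rewrite ?oner_eq0 ?scale1r.
    have [c c0 Ec] := IH (ltnW jk).
    exists (j.+1%:R * (k - j)%:R * c).
      by rewrite !mulf_neq0 // natf_neq0_char0 // subn_gt0.
    have := sl2_comm_iter sl2B' j Bv; rewrite Ev iter_0 => /esym/eqP.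
    rewrite addr_eq0 -scaleNr => /eqP EF.
    rewrite iterSr EF -[X in iter j E X]addr0 iter_lin iter_0 addr0 Ec scalerA.
    congr (_ *: _); rewrite natrB ?(ltnW jk) // natrD; ring.
  exact: H.
exists (c^-1 *: iter k F v).
  apply: (sl2_lin0 sl2B); have := sl2_iter sl2B' Bv (leq_addl a k).
  by rewrite addnK.
by rewrite -[c^-1 *: _]addr0 iter_lin iter_0 addr0 Ec scalerA mulVf ?scale1r.
Qed.

(** By induction [E v = E ^ (k+2) w]; then [v - E ^ (k+1) w] is a highest weight
    vector, to which [sl2_highest] applies. *)
Lemma sl2_lefschetz_surj E F B a k v : bigraded_sl2 E F B -> B (a + k)%N a v ->
  exists2 u, B a (a + k)%N u & iter k E u = v.
Proof.
move=> sl2B; elim: a k v => [|a IH] k v Bv.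
  by apply: (sl2_highest sl2B Bv); apply: (sl2_E0 sl2B Bv).
have [|w Bw Ew] := IH k.+2 (E v); first by rewrite !addnS -addSn; apply: (sl2_E sl2B).
have Bw' : B (a.+1 + k)%N a.+1 (iter k.+1 E w).
  have := sl2_iter sl2B Bw (_ : (k.+1 <= a + k.+2)%N).
  by rewrite (_ : a + k.+2 - k.+1 = a.+1)%N ?addSnnS; [apply; lia|lia].
have [||u Bu Eu] := @sl2_highest _ _ _ a.+1 k (- iter k.+1 E w + v) sl2B.
- by rewrite -scaleN1r; apply: (sl2_lin sl2B).
- by rewrite linearD linearN /= -[E (iter k E _)]/(iter k.+1 E w) -iterS Ew addNr.
exists (E w + u).
  rewrite -[E w]scale1r; apply: (sl2_lin sl2B) => //.
  by apply: (sl2_E sl2B); rewrite addSn -addnS -addnS.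
rewrite -[E w]scale1r iter_lin Eu scale1r -iterSr addrA subrr add0r //.
Qed.

Lemma sl2_inj E F B r a b u : bigraded_sl2 E F B -> B a b u -> (a + r <= b)%N ->
  iter r E u = 0 -> u = 0.
Proof.
move=> sl2B Bu ab Er; apply: (@sl2_lefschetz_inj _ _ _ sl2B a (b - a)).
  by rewrite subnKC // (leq_trans (leq_addr r a)).
have -> : (b - a = (b - a - r) + r)%N by lia.
by rewrite iterD Er iter_0.
Qed.

Lemma sl2_surj E F B r a d v : bigraded_sl2 E F B -> (d <= a)%N -> B (a + r)%N d v ->
  exists2 u, B a (d + r)%N u & iter r E u = v.
Proof.
move=> sl2B da Bv.
have [|u Bu Eu] := @sl2_lefschetz_surj _ _ _ d (a + r - d) v sl2B.
  by rewrite subnKC // (leq_trans da) // leq_addr.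
exists (iter (a - d) E u); last first.
  by rewrite -iterD -Eu; congr (iter _ _ _); lia.
have le_ad : (a - d <= d + (a + r - d))%N by lia.
have := sl2_iter sl2B Bu le_ad.
have -> : (d + (a + r - d) - (a - d) = d + r)%N by lia.
by rewrite subnKC.
Qed.

End Sl2.

(** * Contraction, residues and the polarization operator *)

Section Contraction.
Variables (n : nat) (R : comNzRingType).
Implicit Types (h q : {mpoly R[n]}) (v : 'X_{1..n} -> R) (m a : 'X_{1..n}).

(** The action of a polynomial on inverse polynomials: if [v m] is the
    coefficient of [y ^ (- m - 1)] then [contr h v m] is the corresponding
    coefficient of the product with [h]. *)
Definition contr h v m : R := \sum_(a <- msupp h) h@_a * v (m + a)%MM.

Lemma contrwE k h v m : (msize h <= k)%N ->
  contr h v m = \sum_(a : 'X_{1..n < k}) h@_a * v (m + a)%MM.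
Proof.
move=> hk; rewrite /contr; pose I : subFinType _ := 'X_{1..n < k}.
rewrite (big_mksub I) /=; first last.
- by move=> a /msize_mdeg_lt am; rewrite (leq_trans am).
- by rewrite msupp_uniq.
rewrite big_rmcond //= => i.
by move/memN_msupp_eq0 ->; rewrite mul0r.
Qed.

Lemma contr0 v m : contr 0 v m = 0.
Proof. by rewrite /contr msupp0 big_nil. Qed.

Lemma contrZD c h h' v m : contr (c *: h + h') v m = c * contr h v m + contr h' v m.
Proof.
pose k := maxn (msize (c *: h + h')) (maxn (msize h) (msize h')).
rewrite !(@contrwE k) ?leq_max ?leqnn ?orbT // mulr_sumr -big_split /=.
by apply: eq_bigr => a _; rewrite mcoeffD mcoeffZ mulrDl mulrA.
Qed.

Lemma contrX a v m : contr 'X_[a] v m = v (m + a)%MM.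
Proof. by rewrite /contr msuppX big_seq1 mcoeffX eqxx mul1r. Qed.

Lemma contrD h h' v m : contr (h + h') v m = contr h v m + contr h' v m.
Proof. by have := contrZD 1 h h' v m; rewrite scale1r mul1r. Qed.

Lemma contrZ c h v m : contr (c *: h) v m = c * contr h v m.
Proof. by have := contrZD c h 0 v m; rewrite addr0 contr0 addr0. Qed.

Lemma contr_sum I (r : seq I) (P : pred I) (F : I -> {mpoly R[n]}) v m :
  contr (\sum_(i <- r | P i) F i) v m = \sum_(i <- r | P i) contr (F i) v m.
Proof.
elim/big_rec2: _ => [|i y x _ <-]; first exact: contr0.
exact: contrD.
Qed.

Lemma contr_linear h c v v' m :
  contr h (fun a => c * v a + v' a) m = c * contr h v m + contr h v' m.
Proof.
rewrite /contr mulr_sumr -big_split /=; apply: eq_bigr => a _.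
by rewrite mulrDr mulrCA.
Qed.

Lemma eq_contr h v v' : v =1 v' -> contr h v =1 contr h v'.
Proof. by move=> e m; apply: eq_bigr => a _; rewrite e. Qed.

Lemma contrM h h' v : contr (h * h') v =1 contr h (contr h' v).
Proof.
move=> m; elim/mpolyind: h => [|c a h _ _ IH]; first by rewrite mul0r !contr0.
rewrite mulrDl -scalerAl !contrZD IH contrX; congr (_ * _ + _) => {IH h c}.
elim/mpolyind: h' => [|c b h' _ _ IH]; first by rewrite mulr0 !contr0.
by rewrite mulrDr -scalerAr !contrZD IH -mpolyXD !contrX addmA.
Qed.

Lemma contr1 v : contr 1 v =1 v.
Proof. by move=> m; rewrite -mpolyX0 contrX addm0. Qed.

(** The coefficient of [y ^ (- m - 1)] in [q / (y_1 ... y_n) ^ N]; monomials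
    with an exponent that is not negative die in the top local cohomology. *)
Definition resid N q m : R :=
  if [forall i, (m i < N)%N] then q@_[multinom (N.-1 - m i)%N | i < n] else 0.

Lemma resid_linear N c q q' m : resid N (c *: q + q') m = c * resid N q m + resid N q' m.
Proof.
by rewrite /resid; case: ifP; rewrite ?mulr0 ?addr0 // mcoeffD mcoeffZ.
Qed.

Lemma resid0 N m : resid N 0 m = 0.
Proof. by rewrite /resid mcoeff0 if_same. Qed.

Lemma mcoeffMX_if q a b :
  ('X_[a] * q)@_b = if (a <= b)%MM then q@_(b - a)%MM else 0.
Proof.
case: ifPn => ab; first by rewrite -{1}(submK ab) addmC mulrC mcoeffMX.
apply/eqP; rewrite mcoeff_eq0; apply: contra ab.
move=> /msuppM_le /allpairsP[[c d] /= [ca _ ->]]; move: ca.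
by rewrite msuppX inE => /eqP ->; apply: lem_addr.
Qed.

Lemma residM N h q : resid N (h * q) =1 contr h (resid N q).
Proof.
move=> m; elim/mpolyind: h => [|c a h _ _ IH].
  by rewrite mul0r contr0 resid0.
rewrite mulrDl -scalerAl resid_linear contrZD IH contrX; congr (_ * _ + _).
rewrite /resid mcoeffMX_if; case: ifPn => [/forallP mN|mN]; last first.
  case: ifPn => // /forallP maN; case/negP: mN; apply/forallP => i.
  by apply: leq_ltn_trans (maN i); rewrite mnmDE leq_addr.
case: ifPn => [/mnm_lepP am|am].
  have -> : [forall i, ((m + a)%MM i < N)%N].
    apply/forallP => i; have := am i; rewrite mnmE mnmDE; have := mN i; lia.
  by congr (_@_ _); apply/mnmP => i; rewrite !(mnmE, mnmBE, mnmDE); lia.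
case: ifPn => // /forallP maN; case/negP: am; apply/mnm_lepP => i.
by have := maN i; rewrite mnmDE mnmE; lia.
Qed.

End Contraction.

Section Polarization.
Variables (K : fieldType) (n : nat) (lam : 'rV[K]_n).
Hypothesis lam0 : forall i, lam 0 i != 0.
Local Notation P0 := {mpoly K[n]}.
Local Notation U := ('X_{1..n} -> P0).

Lemma dhomog_mderiv e (p : P0) i : p \is e.+1.-homog -> p^`M(i) \is e.-homog.
Proof.
move=> hp; rewrite [p]mpolyE raddf_sum /=; apply: rpred_sum => m _.
have [pm|pm] := boolP (m \in msupp p); last first.
  by rewrite (memN_msupp_eq0 pm) scale0r mderiv0 dhomog0.
rewrite mderivZ mderivX scalerA.
have [->|mi] := eqVneq (m i) 0%N; first by rewrite mulr0 scale0r dhomog0.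
apply: dhomogZ; rewrite dhomogX.
have := dhomog_mf hp pm => /=; rewrite -{1}(@submK _ U_(i) m) ?lep1mP // mdegD mdeg1.
by rewrite addn1 => -[->].
Qed.

Lemma mderiv_dhomog0 (p : P0) i : p \is 0.-homog -> p^`M(i) = 0.
Proof.
move=> hp; rewrite [p]mpolyE raddf_sum /= big_seq big1 // => m pm.
have /eqP := dhomog_mf hp pm; rewrite /= mdeg_eq0 => /eqP ->.
by rewrite mderivZ mderivX mnm0E scale0r scaler0.
Qed.

Lemma euler_mderiv e (p : P0) : p \is e.-homog -> \sum_i 'X_i * p^`M(i) = e%:R *: p.
Proof.
move=> hp; rewrite {2}[p]mpolyE scaler_sumr.
under eq_bigr do rewrite {1}[p]mpolyE raddf_sum /= mulr_sumr.
rewrite exchange_big /= !big_seq; apply: eq_bigr => m pm.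
rewrite scalerA mulrC -scalerA scaler_nat.
have <- : mdeg m = e by apply: (dhomog_mf hp pm).
rewrite mdegE -sumrMnr scaler_sumr; apply: eq_bigr => i _.
rewrite mderivZ mderivX -!scalerAr scaler_nat.
have [->|mi] := eqVneq (m i) 0%N; first by rewrite !mulr0n.
by rewrite -mpolyXD addmC submK // lep1mP.
Qed.

(** Functions on monomials are polynomials in [z] written in divided powers
    [z ^ (m)]: there [d/dz_i] shifts [m] by [U_(i)] without a coefficient, and
    multiplication by [z_i] sends [z ^ (m)] to [(m_i + 1) z ^ (m + U_(i))],
    whence the factor [m i] in [polF]. *)
Definition polE (v : U) : U := fun m => \sum_i (lam 0 i *: 'X_i) * v (m + U_(i))%MM.
Definition polF (v : U) : U := fun m =>
  \sum_i ((lam 0 i)^-1 * (m i)%:R) *: (v (m - U_(i))%MM)^`M(i).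

Definition bideg e b (v : U) : Prop :=
  (forall m, v m \is e.-homog) /\ (forall m, mdeg m != b -> v m = 0).

Lemma fun_linE c (u v : U) m : (c *: u + v) m = c *: u m + v m.
Proof. by []. Qed.

Lemma polE_linear : linear polE.
Proof.
move=> c u v; apply/funext => m; rewrite fun_linE /polE scaler_sumr -big_split /=.
by apply: eq_bigr => i _; rewrite fun_linE mulrDr -scalerAr.
Qed.
HB.instance Definition _ := GRing.isLinear.Build K U U _ polE polE_linear.

Lemma polF_linear : linear polF.
Proof.
move=> c u v; apply/funext => m; rewrite fun_linE /polF scaler_sumr -big_split /=.
apply: eq_bigr => i _; rewrite fun_linE linearP scalerDr !scalerA.
by congr (_ *: _ + _); rewrite [RHS]mulrC.
Qed.
HB.instance Definition _ := GRing.isLinear.Build K U U _ polF polF_linear.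

(** The terms of the two double sums cancel except on the diagonal, where the
    Euler operators in [x] and in [z] remain; they act as [a] and [b]. *)
Lemma polarization_sl2 : bigraded_sl2 polE polF bideg.
Proof.
split.
- move=> a b c u v [ua ub] [va vb]; split=> m; first by apply: rpredD; rewrite ?rpredZ.
  by move=> mb; rewrite fun_linE ub // vb // scaler0 addr0.
- by move=> a b; split=> m //; apply: dhomog0.
- move=> a b u [ua ub]; split=> m; rewrite /= /polE.
    apply: rpred_sum => i _; rewrite -[a.+1]add1n; apply: dhomogM => //.
    by apply: dhomogZ; rewrite dhomogX /= mdeg1.
  move=> mb; rewrite big1 // => i _; rewrite ub ?mulr0 //.
  by rewrite mdegD mdeg1 addn1 eqSS.
- move=> a u [_ ub]; apply/funext => m; rewrite /= /polE big1 // => i _.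
  by rewrite ub ?mulr0 // mdegD mdeg1 addn1.
- move=> a b u [ua ub]; split=> m; rewrite /= /polF.
    by apply: rpred_sum => i _; apply: dhomogZ; apply: dhomog_mderiv.
  move=> mb; rewrite big1 // => i _.
  have [->|mi] := eqVneq (m i) 0%N; first by rewrite mulr0 scale0r.
  rewrite ub ?mderiv0 ?scaler0 //; apply: contra mb => /eqP <-.
  by rewrite -{1}(@submK _ U_(i) m) ?lep1mP // mdegD mdeg1 addn1.
- move=> b u [ua _]; apply/funext => m; rewrite /= /polF big1 // => i _.
  by rewrite mderiv_dhomog0 ?scaler0.
move=> a b u [ua ub]; apply/funext => m.
rewrite -[LHS]/(polE (polF u) m) -[RHS]/(polF (polE u) m + (a%:R - b%:R) *: u m).
have -> : (a%:R - b%:R) *: u m =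
    \sum_i ('X_i * (u m)^`M(i) - (m i)%:R *: u m).
  rewrite sumrB (euler_mderiv (ua m)) -scaler_suml -natr_sum -mdegE scalerBl.
  have [->//|/ub ->] := eqVneq (mdeg m) b; by rewrite !scaler0.
rewrite /polE /polF.
have -> : \sum_i ('X_i * (u m)^`M(i) - (m i)%:R *: u m) = 
  \sum_k \sum_i (if i == k then 'X_i * (u m)^`M(i) - (m i)%:R *: u m else 0).
  by apply: eq_bigr => i _; rewrite -big_mkcond big_pred1_eq.
under eq_bigr => i _ do rewrite mulr_sumr.
rewrite exchange_big /=.
under [X in _ = X + _]eq_bigr => k _ do rewrite (raddf_sum (mderiv k)) /= scaler_sumr.
rewrite -big_split /=; apply: eq_bigr => k _; rewrite -big_split /=.
apply: eq_bigr => i _.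
rewrite mnmDE mnm1E -scalerAl -scalerAl -scalerAr mderivZ mderivM mderivX.
rewrite mnm1E !scalerA.
have step : forall p : P0, lam 0 i * ((lam 0 k)^-1 * (m k + (i == k))%:R) *: p =
    (lam 0 i * (lam 0 k)^-1 * (m k)%:R) *: p + (if i == k then p else 0).
  move=> p; rewrite natrD mulrDr mulrDr scalerDl mulrA; congr (_ *: _ + _).
  case: eqP => [->|_]; last by rewrite !mulr0 scale0r.
  by rewrite mulr1 divff ?scale1r.
rewrite step [_ * lam 0 i]mulrC [lam 0 i * (_ * _)]mulrA.
have [mk|mk] := eqVneq (m k) 0%N.
  rewrite mk mulr0 !scale0r !add0r; case: eqP => // eik; subst k.
  by rewrite addmK mk scale0r subr0.
have -> : (m + U_(i) - U_(k) = m - U_(k) + U_(i))%MM.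
  by apply/mnmP => j; rewrite !(mnmDE, mnmBE, mnm1E); case: (eqVneq k j) mk => [->|_] //=; lia.
case: (eqVneq i k) => [eik|ik]; last first.
  by rewrite scale0r mul0r add0r !addr0.
subst k; rewrite submK ?lep1mP //.
have -> : (U_(i) - U_(i) = 0 :> 'X_{1..n})%MM.
  by apply/mnmP => j; rewrite mnmBE mnm0E subnn.
rewrite scale1r mpolyX0 mul1r divff // mul1r scalerDr -addrA addrCA.
by congr (_ + _); rewrite addrCA subrr addr0.
Qed.

Lemma contr_flam v : contr (flam lam) v =1 polE v.
Proof.
move=> m; rewrite /flam contr_sum; apply: eq_bigr => i _.
by rewrite contrZ contrX.
Qed.

Lemma contr_flam_exp r v : contr (flam lam ^+ r) v = iter r polE v.
Proof.
apply/funext => m; elim: r v m => [|r IH] v m; first by rewrite expr0 contr1.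
rewrite exprS contrM iterS contr_flam.
by rewrite (_ : contr (flam lam ^+ r) v = iter r polE v) //; apply/funext.
Qed.

End Polarization.

(** * Homogeneous rows and exactness of the Koszul complex in the x variables *)

Section HomogeneousParts.
Variables (K : fieldType) (n : nat).
Local Notation P0 := {mpoly K[n]}.

Lemma pihomogM (R : comNzRingType) d e (q g : {mpoly R[n]}) : g \is e.-homog ->
  pihomog mdeg (d + e) (q * g) = pihomog mdeg d q * g.
Proof.
move=> hg; rewrite {1}(pihomog_partitionE (mf := mdeg) (leqnn (msize q))).
rewrite mulr_suml raddf_sum /=.
have E d' : pihomog mdeg (d + e) (pihomog mdeg d' q * g) =
    if d' == d then pihomog mdeg d q * g else 0.
  have h : pihomog mdeg d' q * g \is (d' + e).-homog.
    by apply: dhomogM hg; apply: pihomogP.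
  case: eqP => [<-|/eqP dd]; first exact: pihomog_dE.
  by rewrite (pihomog_ne0 _ h) // eqn_add2r.
under eq_bigr do rewrite E.
have [dq|qd] := ltnP d (msize q).
  by rewrite -big_mkcond (big_pred1 (Ordinal dq)).
rewrite big1 => [|i _]; last by rewrite ltn_eqF // (leq_trans (ltn_ord i)).
rewrite [pihomog _ _ _](_ : _ = 0) ?mul0r // /pihomog.
rewrite big_seq_cond big1 // => m /andP[/msize_mdeg_lt mq /eqP dm].
by move: mq; rewrite dm ltnNge qd.
Qed.

Definition rhom p e (v : 'rV[P0]_p) : Prop := forall l, v 0 l \is e.-homog.

Definition rpi p e (v : 'rV[P0]_p) : 'rV[P0]_p := map_mx (pihomog mdeg e) v.

Lemma rpiP p e (v : 'rV[P0]_p) : rhom e (rpi e v).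
Proof. by move=> l; rewrite mxE; apply: pihomogP. Qed.

Lemma rpi_sum p (v : 'rV[P0]_p) : exists k, v = \sum_(e < k) rpi e v.
Proof.
exists (\max_l msize (v 0%R l)); apply/rowP => l.
set k := (X in \sum_(e < X) _).
rewrite summxE (eq_bigr (fun e : 'I_k => pihomog mdeg e (v 0 l))).
  by apply: pihomog_partitionE; apply: (leq_bigmax l).
by move=> e _; rewrite mxE.
Qed.

Lemma rhomZ p e c (v : 'rV[P0]_p) : rhom e v -> rhom e (c%:MP *: v).
Proof. by move=> hv l; rewrite mxE mul_mpolyC; apply: dhomogZ. Qed.

Lemma rhomB p e (u v : 'rV[P0]_p) : rhom e u -> rhom e v -> rhom e (u - v).
Proof. by move=> hu hv l; rewrite !mxE; apply: rpredB. Qed.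

Lemma rhom0 p e : rhom e (0 : 'rV[P0]_p).
Proof. by move=> l; rewrite mxE dhomog0. Qed.

Lemma rhom_mulmx p q d e (u : 'rV[P0]_p) (B : 'M[P0]_(p, q)) :
  rhom d u -> (forall k, rhom e (row k B)) -> rhom (d + e) (u *m B).
Proof.
move=> hu hB l; rewrite mxE; apply: rpred_sum => k _; apply: dhomogM => //.
by have := hB k l; rewrite mxE.
Qed.

Lemma rpi_mulmx p q d e (u : 'rV[P0]_p) (B : 'M[P0]_(p, q)) :
  (forall k, rhom e (row k B)) -> rpi (d + e) (u *m B) = rpi d u *m B.
Proof.
move=> hB; apply/rowP => l; rewrite !mxE raddf_sum /=; apply: eq_bigr => k _.
by rewrite mxE pihomogM //; have := hB k l; rewrite mxE.
Qed.

Definition xvar (t : 'I_n) : P0 := 'X_t.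

(** Positive degree of the coefficients suffices in every Koszul degree: a
    monomial of positive degree has a variable in it. *)
Lemma koszul_exact_rows p t (w : {set 'I_n} -> 'rV[P0]_p) :
  (forall T, rhom t.+1 (w T)) -> kosd xvar w =1 (fun=> 0) ->
  exists w' : {set 'I_n} -> 'rV[P0]_p,
    (forall T, rhom t (w' T)) /\ kosd xvar w' =1 w.
Proof.
move=> hw dw.
have coordE (w0 : {set 'I_n} -> 'rV[P0]_p) l T :
    (kosd xvar w0 T) 0 l = kosd (@ypow n K 1) (fun T => w0 T 0 l : P0^o) T.
  rewrite /kosd summxE; apply: eq_bigr => s _.
  by rewrite !mxE /ypow expr1.
have H l : exists w' : {set 'I_n} -> P0,
    (forall T, w' T \is t.-homog) /\
    kosd (@ypow n K 1) (w' : _ -> P0^o) =1 fun T => w T 0 l.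
  have [||w' [dw' hw']] := @koszul_exact n K 1 (fun T => w T 0 l).
  - move=> T m wm.
    have : mdeg m = t.+1 by apply: (dhomog_mf (hw T l)); rewrite mcoeff_msupp.
    have [s ms|m0] := pickP (fun s => m s != 0%N).
      by exists s; rewrite lt0n ms orbT.
    rewrite mdegE big1 // => i _; apply/eqP; have := m0 i.
    by case: (m i).
  - by move=> T; rewrite -coordE dw mxE.
  exists w'; split=> // T; apply/dhomogP => m; rewrite mcoeff_msupp => wm.
  have [s [b [sT e]]] := hw' T m wm.
  have : mdeg (m + U_(s) *+ 1)%MM = t.+1.
    apply: (dhomog_mf (hw (s |: T) l)); rewrite mcoeff_msupp.
    by apply: contraNneq wm => w0; rewrite e w0 mulr0.
  by rewrite mdegD mdegMn mdeg1 addn1 => -[].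
have [w' Hw'] := fin_all_exists H.
exists (fun T => \row_l w' l T); split=> [T l|T]; first by rewrite mxE; apply: (Hw' l).1.
apply/rowP => l; rewrite coordE -(Hw' l).2; apply: eq_bigr => s _.
by rewrite mxE.
Qed.

End HomogeneousParts.

Section Subspace.
Variable K : fieldType.

(** A family of independent vectors of [W] of largest size spans [W]. *)
Lemma subspace_basis D (W : 'rV[K]_D -> Prop) :
  W 0 -> (forall c u v, W u -> W v -> W (c *: u + v)) ->
  exists p (B : 'M[K]_(p, D)), [/\ row_free B, forall k, W (row k B) &
    forall v, W v -> exists c : 'rV_p, v = c *m B].
Proof.
move=> W0 WD.
pose Q p := `[< exists B : 'M[K]_(p, D), row_free B /\ forall k, W (row k B) >].
have exQ : exists p, Q p.
  exists 0%N; apply/asboolP; exists 0; split=> [|[]//].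
  by rewrite /row_free mxrank0.
have Qle p : Q p -> (p <= D)%N.
  by move=> /asboolP[B [/eqP fB _]]; rewrite -[p]fB; apply: rank_leq_col.
case: (ex_maxnP exQ Qle) => p /asboolP[B [fB WB]] max_p.
exists p, B; split=> // v Wv; apply/submxP; apply: contraT => vB.
suff /max_p : Q (1 + p)%N by rewrite ltnn.
apply/asboolP; exists (col_mx v B); split; last first.
  move=> k; case: (split_ordP k) => i ->.
    by rewrite rowKu row_id.
  by rewrite rowKd.
apply: inj_row_free => u; rewrite -[u]hsubmxK mul_row_col.
rewrite [lsubmx u]mx11_scalar mul_scalar_mx; set a := _ 0 0.
have [->|a0] := eqVneq a 0.
  rewrite scale0r add0r => /eqP; rewrite mulmx_free_eq0 // => /eqP ->.
  by rewrite raddf0 row_mx0.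
move/eqP; rewrite addrC addr_eq0 => /eqP e; case/negP: vB.
have -> : v = - a^-1 *: (rsubmx u *m B).
  by rewrite e scalerN scaleNr opprK scalerA mulVf ?scale1r.
by rewrite scalemx_sub // submxMl.
Qed.

End Subspace.

(** * Linear resolutions from vanishing Koszul cohomology *)

Section DegreePiece.
Variables (K : fieldType) (n p e : nat).
Local Notation P0 := {mpoly K[n]}.
Local Notation J := ('X_{1..n < e.+1} * 'I_p)%type.

Definition of_coords (c : 'rV[K]_#|{: J}|) : 'rV[P0]_p :=
  \row_l \sum_(m : 'X_{1..n < e.+1}) c 0 (enum_rank (m, l)) *: 'X_[m].

Lemma of_coords_mulmx q (c : 'rV[K]_q) (B : 'M[K]_(q, _)) :
  of_coords (c *m B) =
  map_mx (@mpolyC n K) c *m (\matrix_k of_coords (row k B)).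
Proof.
apply/rowP => l; rewrite !mxE.
under [RHS]eq_bigr => k _ do rewrite !mxE mulr_sumr.
rewrite exchange_big; apply: eq_bigr => m _ /=.
rewrite mxE scaler_suml; apply: eq_bigr => k _.
by rewrite mxE mul_mpolyC scalerA.
Qed.

Lemma of_coordsZD a c c' :
  of_coords (a *: c + c') = a%:MP *: of_coords c + of_coords c'.
Proof.
apply/rowP => l; rewrite !mxE mulr_sumr -big_split; apply: eq_bigr => m _ /=.
by rewrite !mxE scalerDl mul_mpolyC scalerA.
Qed.

Lemma of_coords_eq0 c : of_coords c = 0 -> c = 0.
Proof.
move=> c0; apply/rowP => i; rewrite mxE -[i]enum_valK; case: (enum_val i) => m l.
have := congr1 (fun v : 'rV_p => (v 0 l)@_m) c0.
rewrite !mxE mcoeff0 raddf_sum /= (bigD1 m) //= mcoeffZ mcoeffX eqxx mulr1.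
rewrite big1 ?addr0 // => m' mm'; rewrite mcoeffZ mcoeffX.
by rewrite -bmeqP (negbTE mm') mulr0.
Qed.

Lemma of_coords_surj v : rhom e v -> exists c, v = of_coords c.
Proof.
move=> hv; exists (\row_(i < #|{: J}|) (v 0 (enum_val i : J).2)@_((enum_val i : J).1)).
apply/rowP => l; rewrite mxE.
under eq_bigr do rewrite mxE enum_rankK /=.
apply: mpolywE; rewrite msizeE; apply/bigmax_leqP_seq => m mv _.
by rewrite (dhomog_mf (hv l) mv).
Qed.

End DegreePiece.

Section LinearResolution.
Variables (K : fieldType) (n : nat).
Local Notation P0 := {mpoly K[n]}.
Local Notation xvar := (@xvar K n).

Definition graded_sub p (Z : 'rV[P0]_p -> Prop) : Prop :=
  [/\ Z 0, forall c u v, Z u -> Z v -> Z (c *: u + v) &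
      forall e v, Z v -> Z (rpi e v)].

(** Castelnuovo-Mumford regularity at most [e]: no Koszul cohomology with
    coefficients in degrees above [e].  All Koszul degrees are treated at once,
    since the coefficient degree [t] of a class of homological degree [i] gives
    its internal degree [t + i]. *)
Definition koszul_regular p (Z : 'rV[P0]_p -> Prop) (e : nat) : Prop :=
  forall t (w : {set 'I_n} -> 'rV[P0]_p), (e <= t)%N ->
    (forall T, rhom t.+1 (w T)) -> (forall T, Z (w T)) ->
    kosd xvar w =1 (fun=> 0) ->
  exists w' : {set 'I_n} -> 'rV[P0]_p,
    [/\ forall T, rhom t (w' T), forall T, Z (w' T) & kosd xvar w' =1 w].

(** Regularity at most [e] and nothing below degree [e]. *)
Definition linear_module p (Z : 'rV[P0]_p -> Prop) (e : nat) : Prop :=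
  [/\ graded_sub Z, koszul_regular Z e &
      forall t v, (t < e)%N -> rhom t v -> Z v -> v = 0].

Definition degree_basis p (Z : 'rV[P0]_p -> Prop) e q (B : 'M[P0]_(q, p)) : Prop :=
  [/\ forall k, rhom e (row k B), forall k, Z (row k B),
      forall c : 'rV[K]_q, map_mx (@mpolyC n K) c *m B = 0 -> c = 0 &
      forall v, rhom e v -> Z v -> exists c : 'rV[K]_q, v = map_mx (@mpolyC n K) c *m B].

Lemma degree_basis_exists p (Z : 'rV[P0]_p -> Prop) e : graded_sub Z ->
  exists q (B : 'M[P0]_(q, p)), degree_basis Z e B.
Proof.
move=> [Z0 ZD _].
pose W c := rhom e (of_coords c) /\ Z (@of_coords K n p e c).
have of0 : @of_coords K n p e 0 = 0.
  by apply/rowP => l; rewrite !mxE big1 // => m _; rewrite mxE scale0r.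
have [||q [B [fB WB spanB]]] := @subspace_basis K _ W.
- by split; rewrite of0 //; apply: rhom0.
- move=> c u v [hu Zu] [hv Zv]; split; rewrite of_coordsZD; last exact: ZD.
  by move=> l; rewrite mxE; apply: rpredD; [apply: (rhomZ c hu)|apply: hv].
exists q, (\matrix_k of_coords (row k B)); split.
- by move=> k; rewrite rowK; apply: (WB k).1.
- by move=> k; rewrite rowK; apply: (WB k).2.
- move=> c; rewrite -of_coords_mulmx => /of_coords_eq0 /eqP.
  by rewrite mulmx_free_eq0 // => /eqP.
move=> v hv Zv; have [c vc] := of_coords_surj hv.
have [|c' cc] := spanB c; first by rewrite /W -vc.
by exists c'; rewrite -of_coords_mulmx -cc.
Qed.

Lemma graded_sub_sum p (Z : 'rV[P0]_p -> Prop) I (r : seq I) (Q : pred I) F :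
  graded_sub Z -> (forall i, Q i -> Z (F i)) -> Z (\sum_(i <- r | Q i) F i).
Proof.
move=> [Z0 ZD _] ZF; elim/big_rec: _ => // i v Qi Zv.
by rewrite -[F i]scale1r; apply: ZD => //; apply: ZF.
Qed.

Lemma graded_sub_mulmx p (Z : 'rV[P0]_p -> Prop) q (B : 'M[P0]_(q, p)) u :
  graded_sub Z -> (forall k, Z (row k B)) -> Z (u *m B).
Proof.
move=> Zg ZB; rewrite mulmx_sum_row; apply: graded_sub_sum => // k _.
by case: Zg => Z0 ZD _; rewrite -[_ *: _]addr0; apply: ZD.
Qed.

Lemma rhom_kosd p t (w : {set 'I_n} -> 'rV[P0]_p) T :
  (forall T, rhom t (w T)) -> rhom t.+1 (kosd xvar w T).
Proof.
move=> hw l; rewrite /kosd summxE; apply: rpred_sum => s _.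
rewrite !mxE -signr_odd; have h : 'X_s * w (T :\ s) 0 l \is t.+1.-homog.
  by rewrite -[t.+1]add1n; apply: dhomogM; [rewrite dhomogX /= mdeg1|apply: hw].
by case: odd; rewrite ?expr1 ?mulN1r ?rpredN ?expr0 ?mul1r.
Qed.

Section Stage.
Variables (p : nat) (Z : 'rV[P0]_p -> Prop) (e q : nat) (B : 'M[P0]_(q, p)).
Hypotheses (linZ : linear_module Z e) (basB : degree_basis Z e B).

(** An element of degree above [e] is a top-degree Koszul cocycle, hence a
    combination of the variables with coefficients one degree lower. *)
Lemma linear_module_gen t v : rhom (t + e) v -> Z v ->
  exists2 u, rhom t u & v = u *m B.
Proof.
case: linZ basB => gZ regZ lowZ [hB ZB freeB spanB].
elim: t v => [|t IH] v hv Zv.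
  have [c ->] := spanB v hv Zv; exists (map_mx (@mpolyC n K) c) => // l.
  by rewrite mxE; apply/dhomogP => m; rewrite msuppC; case: ifP => // _; rewrite inE => /eqP ->; apply: mdeg0.
pose w (T : {set 'I_n}) := if T == [set: 'I_n] then v else 0.
have [||||w' [hw' Zw' dw']] := regZ (t + e)%N w.
- exact: leq_addl.
- by move=> T; rewrite /w; case: ifP => // _; apply: rhom0.
- by move=> T; rewrite /w; case: ifP => // _; case: gZ.
- move=> T; rewrite /kosd big1 // => s sT; rewrite /w.
  case: eqP => [TT|_]; last by rewrite !scaler0.
  by have := finset.in_setT s; rewrite -TT !inE eqxx.
have H T : exists u, rhom t u /\ w' T = u *m B.
  by have [u hu ->] := IH _ (hw' T) (Zw' T); exists u.
have [u Hu] := fin_all_exists H.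
have <- : kosd xvar w' [set: 'I_n] = v by rewrite dw' /w eqxx.
exists (kosd xvar u [set: 'I_n]).
  by apply: rhom_kosd => T; apply: (Hu T).1.
rewrite /kosd mulmx_suml; apply: eq_bigr => s _.
by rewrite -!scalemxAl (Hu _).2.
Qed.

Lemma linear_module_span v : Z v <-> exists u, v = u *m B.
Proof.
case: linZ basB => gZ regZ lowZ [hB ZB freeB spanB].
split=> [Zv|[u ->]]; last exact: graded_sub_mulmx.
have [k ->] := rpi_sum v.
have H (d : 'I_k) : exists u, rpi d v = u *m B.
  have Zd : Z (rpi d v) by case: gZ => _ _; apply.
  have [de|ed] := ltnP d e.
    by exists 0; rewrite mul0mx; apply: lowZ de _ Zd; apply: rpiP.
  have [|u _ ->] := @linear_module_gen (d - e) _ _ Zd; last by exists u.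
  by rewrite subnK //; apply: rpiP.
have [u Hu] := fin_all_exists H.
by exists (\sum_d u d); rewrite mulmx_suml; apply: eq_bigr.
Qed.

(** The long exact sequence of Koszul cohomology, followed on elements: a
    cocycle of syzygies bounds in the free module; the image of the primitive is
    a cocycle of [Z], which bounds in [Z]; correcting the primitive by a lift of
    that second primitive makes it a syzygy.  There is no syzygy of degree
    zero, as the rows of [B] are independent over [K]. *)
Lemma linear_module_syzygies : linear_module (fun u : 'rV[P0]_q => u *m B = 0) 1.
Proof.
case: linZ basB => gZ regZ lowZ [hB ZB freeB spanB]; split.
- split=> [|c u v hu hv|d v hv]; first exact: mul0mx.
    by rewrite mulmxDl -scalemxAl hu hv scaler0 addr0.
  by rewrite -(rpi_mulmx d v hB) hv; apply/rowP => l; rewrite !mxE raddf0.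
- move=> [//|t] w _ hw Zw dw.
  have [w1 [hw1 dw1]] := koszul_exact_rows hw dw.
  have dw1B : kosd xvar (fun T => w1 T *m B) =1 fun T => 0.
    by move=> T; rewrite (kosd_linear (mulmxr B)) /= dw1 Zw.
  have [||||w2 [hw2 Zw2 dw2]] := regZ (t + e)%N (fun T => w1 T *m B).
  - exact: leq_addl.
  - by move=> T; rewrite -addSn; apply: rhom_mulmx.
  - by move=> T; apply: graded_sub_mulmx.
  - exact: dw1B.
  have H T : exists u, rhom t u /\ w2 T = u *m B.
    by have [u hu ->] := linear_module_gen (hw2 T) (Zw2 T); exists u.
  have [w3 Hw3] := fin_all_exists H.
  exists (fun T => w1 T - kosd xvar w3 T); split=> T.
  + by apply: rhomB => //; apply: rhom_kosd => T'; apply: (Hw3 T').1.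
  + rewrite mulmxBl -dw2; have := kosd_linear (mulmxr B) xvar w3 T => /= <-.
    apply/eqP.
    by rewrite subr_eq0; apply/eqP/eq_kosd => T'; rewrite (Hw3 _).2.
  by rewrite kosdB kosdK subr0 dw1.
move=> t v; rewrite ltnS leqn0 => /eqP -> hv vB.
have [c vc] : exists c, v = map_mx (@mpolyC n K) c.
  exists (map_mx (fun a : P0 => a@_0%MM) v); apply/rowP => l; rewrite !mxE.
  apply: msize1_polyC; rewrite msizeE; apply/bigmax_leqP_seq => m mv _.
  by rewrite (dhomog_mf (hv l) mv).
by rewrite vc; move: vB; rewrite vc => /freeB ->; rewrite map_mx0.
Qed.

End Stage.

Record stage := Stage {
  stage_dim : nat;
  stage_mod : 'rV[P0]_stage_dim -> Prop;
  stage_deg : nat;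
  stage_lin : linear_module stage_mod stage_deg
}.

Theorem linear_module_resolution p (Z : 'rV[P0]_p -> Prop) e : linear_module Z e ->
  exists (rk : nat -> nat) (B0 : 'M[P0]_(rk 0%N, p))
         (D : forall i, 'M[P0]_(rk i.+1, rk i)),
    [/\ forall k, rhom e (row k B0) /\ Z (row k B0),
        forall v, Z v <-> exists u, v = u *m B0,
        forall u : 'rV_(rk 0%N), u *m B0 = 0 <-> exists w, u = w *m D 0%N,
        forall i (u : 'rV_(rk i.+1)), u *m D i = 0 <-> exists w, u = w *m D i.+1 &
        forall i k l, D i k l \is 1.-homog].
Proof.
move=> linZ.
have basis (s : stage) : {qB : {q & 'M[P0]_(q, stage_dim s)} |
    degree_basis (@stage_mod s) (stage_deg s) (projT2 qB)}.
  apply: cid; have [gs _ _] := stage_lin s.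
  by have [q [B bB]] := degree_basis_exists (stage_deg s) gs; exists (existT _ q B).
pose Bs s := projT2 (sval (basis s)).
pose next s := Stage (linear_module_syzygies (stage_lin s) (svalP (basis s))).
pose st i := iter i next (Stage linZ).
exists (fun i => stage_dim (st i.+1)), (Bs (st 0%N)), (fun i => Bs (st i.+1)); split.
- by move=> k; have [hB ZB _ _] := svalP (basis (st 0%N)); split; [apply: hB|apply: ZB].
- exact: linear_module_span (stage_lin (st 0%N)) (svalP (basis (st 0%N))).
- exact: linear_module_span (stage_lin (st 1%N)) (svalP (basis (st 1%N))).
- move=> i; exact: linear_module_span (stage_lin (st i.+2)) (svalP (basis (st i.+2))).
move=> i k l; have [hB _ _ _] := svalP (basis (st i.+1)).
by have := hB k l; rewrite mxE.
Qed.

(** [Rel] is the graph of an isomorphism from [Z] to [G].  A relation is used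
    since the elements of [G] in view are classes of cocycles, for which linear
    representatives would require further choices. *)
Theorem linear_resolution_criterion p (Z : 'rV[P0]_p -> Prop) e
    (G : graded_module K n) (d : int) (Rel : 'rV[P0]_p -> gambient G -> Prop) :
  linear_module Z e ->
  Rel 0 0 ->
  (forall c v v' h h', Rel v h -> Rel v' h' -> Rel (c *: v + v') (c *: h + h')) ->
  (forall v h, Rel v h -> h = 0 <-> v = 0) ->
  (forall v, Z v -> rhom e v -> exists2 h, @gcomp _ _ G d h & Rel v h) ->
  (forall i h, @gcomp _ _ G i h -> exists2 v, Z v & Rel v h) ->
  has_linear_resolution G.
Proof.
move=> linZ Rel0 RelD RelE Rel_ex Rel_onto.
have [rk [B0 [D [hB0 spanB0 exB0 exD hD]]]] := linear_module_resolution linZ.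
have H k : exists h, @gcomp _ _ G d h /\ Rel (row k B0) h.
  by have [h] := Rel_ex _ (hB0 k).2 (hB0 k).1; exists h.
have [aug Haug] := fin_all_exists H.
have Rel_sum (u : 'rV[P0]_(rk 0%N)) : Rel (u *m B0) (\sum_k u 0 k *: aug k).
  rewrite mulmx_sum_row; elim/big_rec2: _ => // k h v _ Rvh.
  by apply: RelD => //; apply: (Haug k).2.
have xh1 (z : int) (q : P0) : q \is 1.-homog -> z = 1 -> xhomog z q.
  by move=> hq -> m mq; rewrite (dhomog_mf hq mq).
unshelve eexists d, (@GradedFreeResolution K n G rk (fun i _ => d + i%:Z) D aug _ _ _ _ _).
- by move=> i k l; apply: xh1; rewrite ?hD //; lia.
- by move=> k /=; rewrite addr0; apply: (Haug k).1.
- exact: exD.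
- move=> u; rewrite -exB0; exact: RelE.
- move=> i h Gh; have [v Zv Rvh] := Rel_onto _ _ Gh.
  have [u vu] := (spanB0 v).1 Zv; exists u.
  have := RelD (-1) _ _ _ _ (Rel_sum u) Rvh; rewrite !scaleN1r -vu addNr => /RelE.
  by case=> _ /(_ erefl) /eqP; rewrite addrC subr_eq0 => /eqP.
split=> // i k l /=; apply: (dhomog_nemf_coeff (hD i k l)).
by rewrite /= mdeg0.
Qed.

End LinearResolution.

(** * The kernel of contraction with a power of the bilinear form *)

Section MonomialRows.
Variables (R : comNzRingType) (n b : nat).
Local Notation J := {m : 'X_{1..n < b.+1} | mdeg m == b}.

Definition nmon : nat := #|{: J}|.
Definition mon (i : 'I_nmon) : 'X_{1..n} := val (val (enum_val i : J)).

Lemma mdeg_mon i : mdeg (mon i) = b.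
Proof. by apply/eqP; apply: (valP (enum_val i : J)). Qed.

Lemma mon_inj : injective mon.
Proof. by move=> i i' /val_inj/val_inj/enum_val_inj. Qed.

Lemma mon_surj m : mdeg m = b -> exists i, mon i = m.
Proof.
move=> mb; have lt_mb : (mdeg m < b.+1)%N by rewrite mb.
have mb' : mdeg (BMultinom lt_mb) == b by apply/eqP.
by exists (enum_rank (Sub (BMultinom lt_mb) mb' : J)); rewrite /mon enum_rankK SubK.
Qed.

Definition row_fun (v : 'rV[R]_nmon) (m : 'X_{1..n}) : R :=
  \sum_i (if mon i == m then v 0 i else 0).

Definition fun_row (f : 'X_{1..n} -> R) : 'rV[R]_nmon := \row_i f (mon i).

Lemma row_fun_mon v i : row_fun v (mon i) = v 0 i.
Proof.
rewrite /row_fun -big_mkcond (big_pred1 i) // => i' /=.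
by rewrite (inj_eq mon_inj).
Qed.

Lemma row_fun_out v m : mdeg m != b -> row_fun v m = 0.
Proof.
move=> mb; rewrite /row_fun big1 // => i _; case: eqP => // e.
by rewrite -e mdeg_mon eqxx in mb.
Qed.

Lemma fun_rowK v : fun_row (row_fun v) = v.
Proof. by apply/rowP => i; rewrite mxE row_fun_mon. Qed.

Lemma row_funK f : (forall m, mdeg m != b -> f m = 0) -> row_fun (fun_row f) =1 f.
Proof.
move=> hf m; have [/mon_surj[i <-]|mb] := eqVneq (mdeg m) b.
  by rewrite row_fun_mon mxE.
by rewrite row_fun_out // hf.
Qed.

Lemma row_fun_linear c u v m : row_fun (c *: u + v) m = c * row_fun u m + row_fun v m.
Proof.
rewrite /row_fun mulr_sumr -big_split; apply: eq_bigr => i _ /=.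
by case: ifP => _; rewrite ?mulr0 ?addr0 // !mxE.
Qed.

End MonomialRows.

Arguments mon {n b} i.

Section ContractionKernel.
Variables (K : fieldType) (n : nat).
Hypothesis charK : [pchar K] =i pred0.
Variable lam : 'rV[K]_n.
Hypothesis lam0 : forall i, lam 0 i != 0.
Variables (r d : nat).
Local Notation P0 := {mpoly K[n]}.
Local Notation P := {mpoly {mpoly K[n]}[n]}.
Local Notation g := (flam lam ^+ r).

Lemma flam_exp_dhomog : g \is r.-homog.
Proof.
rewrite -{2}[r]mul1n; apply: dhomogMn; apply: rpred_sum => i _.
by apply: dhomogZ; rewrite dhomogX /= mdeg1.
Qed.

Definition xdhomog (e : nat) (p : P) : Prop := forall m, p@_m \is e.-homog.

Lemma xdhomogM e e' (p q : P) : xdhomog e p -> xdhomog e' q -> xdhomog (e + e') (p * q).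
Proof.
by move=> hp hq m; rewrite mcoeffM; apply: rpred_sum => k _; apply: dhomogM.
Qed.

Lemma flam_exp_xdhomog : xdhomog r g.
Proof.
elim: r => [|k IH] m.
  by rewrite expr0 mcoeff1; case: eqP => _; [apply: dhomog1|apply: dhomog0].
rewrite exprS -add1n; apply: xdhomogM => // m'.
rewrite raddf_sum; apply: rpred_sum => i _ /=; rewrite mcoeffZ mcoeffX.
case: eqP => _; rewrite ?mulr0 ?dhomog0 // mulr1; apply: dhomogZ.
by rewrite dhomogX /= mdeg1.
Qed.

Definition contr_rows (v : 'rV[P0]_(nmon n (d + r))) : 'rV[P0]_(nmon n d) :=
  fun_row d (contr g (row_fun v)).

Lemma contr_rows_linear : linear contr_rows.
Proof.
move=> c u v; apply/rowP => i; rewrite !mxE -contr_linear.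
by apply: eq_contr => m; rewrite row_fun_linear.
Qed.
HB.instance Definition _ := GRing.isLinear.Build P0 _ _ _ contr_rows contr_rows_linear.

Lemma row_fun_contr v : row_fun (contr_rows v) =1 contr g (row_fun v).
Proof.
apply: row_funK => m md; rewrite /contr big_seq big1 // => a ga.
rewrite row_fun_out ?mulr0 // mdegD (dhomog_mf flam_exp_dhomog ga).
by rewrite eqn_add2r.
Qed.

Lemma contr_rows_eq0 v : contr_rows v = 0 <-> iter r (polE lam) (row_fun v) = 0.
Proof.
rewrite -contr_flam_exp; split=> [v0|v0].
  apply/funext => m; rewrite -row_fun_contr v0.
  by rewrite /row_fun big1 // => i _; rewrite mxE if_same.
by rewrite -[contr_rows v]fun_rowK; apply/rowP => i; rewrite !mxE row_fun_contr v0.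
Qed.

Lemma row_fun_bideg b e v : rhom e v -> bideg e b (@row_fun P0 n b v).
Proof.
move=> hv; split=> m; last exact: row_fun_out.
by apply: rpred_sum => i _; case: ifP => _; [apply: hv|apply: dhomog0].
Qed.

Lemma rhom_contr_rows e v : rhom e v -> rhom (e + r) (contr_rows v).
Proof.
move=> hv i; rewrite mxE; apply: rpred_sum => a _; rewrite [(e + r)%N]addnC.
by apply: dhomogM; [apply: flam_exp_xdhomog|apply: (row_fun_bideg hv).1].
Qed.

Lemma rpi_contr_rows e v : contr_rows (rpi e v) = rpi (e + r) (contr_rows v).
Proof.
apply/rowP => i; rewrite !mxE raddf_sum; apply: eq_bigr => a _ /=.
rewrite mulrC [in RHS]mulrC pihomogM; last exact: flam_exp_xdhomog.
congr (_ * _); rewrite raddf_sum; apply: eq_bigr => k _ /=.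
by case: ifP => _; rewrite ?mxE ?raddf0.
Qed.

(** The Koszul chase runs through [F_1 -> F_0]: the primitive [w1] of a cocycle
    of the kernel has an image in [F_0] which bounds some [w2]; the degree of
    [w2] is large enough for the Lefschetz property to lift it to [F_1], and the
    lift corrects [w1] into the kernel. *)
Theorem contr_kernel_linear : linear_module (fun v => contr_rows v = 0) d.+1.
Proof.
have sl2 := polarization_sl2 lam0.
split.
- split=> [|c u v hu hv|e v hv]; first exact: linear0.
    by rewrite contr_rows_linear hu hv scaler0 addr0.
  by rewrite rpi_contr_rows hv; apply/rowP => i; rewrite !mxE raddf0.
- move=> [//|t] w dt hw Zw dw; rewrite ltnS in dt.
  have [w1 [hw1 dw1]] := koszul_exact_rows hw dw.
  have [||w2 [hw2 dw2]] := @koszul_exact_rows _ _ _ (t + r) (fun T => contr_rows (w1 T)).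
  + by move=> T; rewrite -addSn; apply: rhom_contr_rows.
  + by move=> T; rewrite (kosd_linear contr_rows) dw1 /= Zw.
  have H T : exists u, rhom t u /\ contr_rows u = w2 T.
    have [u [hu su] Eu] := sl2_surj charK sl2 dt (row_fun_bideg (hw2 T)).
    exists (fun_row _ u); split; first by move=> l; rewrite mxE.
    rewrite -[RHS]fun_rowK -Eu; apply/rowP => i; rewrite !mxE -contr_flam_exp.
    by apply: eq_contr; apply: row_funK.
  have [w3 Hw3] := fin_all_exists H.
  exists (fun T => w1 T - kosd (@xvar K n) w3 T); split=> T.
  + by apply: rhomB => //; apply: rhom_kosd => T'; apply: (Hw3 T').1.
  + rewrite linearB /= -dw2; have /= <- := kosd_linear contr_rows (@xvar K n) w3 T.
    by apply/eqP; rewrite subr_eq0; apply/eqP/eq_kosd => T'; rewrite (Hw3 _).2.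
  by rewrite kosdB kosdK subr0 dw1.
move=> t v; rewrite ltnS => td hv /contr_rows_eq0 /(sl2_inj charK sl2 (row_fun_bideg hv)).
by rewrite leq_add2r => /(_ td) v0; rewrite -[v]fun_rowK v0; apply/rowP => i; rewrite !mxE.
Qed.

End ContractionKernel.

(** * Cech cochains with a common denominator *)

Lemma kosd_twist n (R : comNzRingType) (x z : 'I_n -> R) (Z : {set 'I_n} -> R)
    (w : {set 'I_n} -> R^o) (T : {set 'I_n}) :
  (forall (S : {set 'I_n}) t, t \in S -> Z S = z t * Z (S :\ t)) ->
  kosd (fun t => x t * z t) (fun T => Z T * w T : R^o) T = Z T * kosd x w T.
Proof.
move=> hZ; rewrite /kosd mulr_sumr; apply: eq_bigr => t tT.
have E (a b c : R) : a *: (b *: (c : R^o)) = a * (b * c) by [].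
by rewrite !E (hZ T t tT); ring.
Qed.

Section CechNumerators.
Variables (K : fieldType) (n : nat).
Local Notation P0 := {mpoly K[n]}.
Local Notation P := {mpoly {mpoly K[n]}[n]}.
Variables (g : P) (M : lmodType P) (cl : P -> M).
Local Notation yv := (@yvar K n).
Local Notation Y := (yprod yv).
Local Notation yN := (@ypow n {mpoly K[n]}).
Implicit Types (w b : {set 'I_n} -> P^o) (T : {set 'I_n}).

(** [cl] presents [M] as the quotient of [P] by the ideal of [g]. *)
Record presents : Prop := {
  clD : forall p p', cl (p + p') = cl p + cl p';
  clZ : forall a p, a *: cl p = cl (a * p);
  cl_eq : forall p p', cl p = cl p' <-> exists k, p - p' = k * g;
  cl_surj : forall m, exists p, m = cl p
}.
Hypothesis clP : presents.

Lemma cl0 : cl 0 = 0.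
Proof. by rewrite -[RHS](scale0r (cl 0)) (clZ clP) mul0r. Qed.

Definition clf (N : nat) T (p : P) : loc M (Y T) := Defs.frac (Y T) (cl p) N.

Lemma clf0 N T : clf N T 0 = 0.
Proof. by apply/fracP; exists 0%N; rewrite cl0 !scaler0. Qed.

Lemma clf_eq T N N' p p' : clf N T p = clf N' T p' <->
  exists c k, Y T ^+ (c + N') * p - Y T ^+ (c + N) * p' = k * g.
Proof.
split=> [/fracP[c]|[c [k h]]].
  by rewrite !(clZ clP) => /(cl_eq clP)[k h]; exists c, k.
by apply/fracP; exists c; rewrite !(clZ clP); apply/(cl_eq clP); exists k.
Qed.

Lemma clf_eq1 T N p p' k : p - p' = k * g -> clf N T p = clf N T p'.
Proof.
move=> h; apply/clf_eq; exists 0%N, (Y T ^+ N * k).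
by rewrite -mulrBr h mulrA.
Qed.

Lemma clf_raise T N c p : clf (N + c) T (Y T ^+ c * p) = clf N T p.
Proof.
apply/clf_eq; exists 0%N, 0; rewrite mul0r mulrA -exprD.
by rewrite !add0n subrr.
Qed.

Lemma clfD N T p p' : clf N T (p + p') = clf N T p + clf N T p'.
Proof. by rewrite /clf (clD clP) -[RHS]/(locD _ _) frac_same. Qed.

Lemma clfZ N T a p : a *: clf N T p = clf N T (a * p).
Proof. by rewrite /clf -[LHS]/(locZ _ _) locZE (clZ clP). Qed.

Lemma clf_sum N T I (r : seq I) (Q : pred I) F :
  clf N T (\sum_(i <- r | Q i) F i) = \sum_(i <- r | Q i) clf N T (F i).
Proof.
elim/big_rec2: _ => [|i x y _ <-]; first exact: clf0.
exact: clfD.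
Qed.

Lemma clf_surj T (x : loc M (Y T)) : exists N p, x = clf N T p.
Proof.
have [m [N ->]] := frac_surj x; have [p ->] := cl_surj clP m.
by exists N, p.
Qed.

Definition cochain_of N w : cech M yv := fun T => clf N T (w T).

Lemma cechd_cochain_of N w : cechd (cochain_of N w) = cochain_of N (kosd (yN N) w).
Proof.
apply: functional_extensionality_dep => T.
rewrite /cechd /cochain_of /kosd clf_sum; apply: eq_bigr => t tT.
rewrite {1}/clf (locmapE (yprodD1 yv tT)) (clZ clP) -[Defs.frac _ _ _]/(clf N T _) clfZ.
by [].
Qed.

Lemma kosd_raise N c w T :
  kosd (yN (N + c)) (fun T => Y T ^+ c * w T : P^o) T = Y T ^+ c * kosd (yN N) w T.
Proof.
rewrite -(@kosd_twist n P (yN N) (fun t => yv t ^+ c) (fun T => Y T ^+ c)); last first.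
  by move=> S t tS; rewrite (yprodD1 yv tS) exprMn.
by apply: eq_bigr => t _; rewrite /ypow exprD.
Qed.

Lemma kosd_supp N k w T : (forall T, #|T| != k -> w T = 0) -> #|T| != k.+1 ->
  kosd (yN N) w T = 0.
Proof.
move=> hw Tk; rewrite /kosd big1 // => t tT; rewrite hw ?scaler0 //.
by apply: contra Tk => /eqP <-; rewrite (cardsD1 t T) tT add1n.
Qed.

Lemma yprodX T : (@mpolyX n P0 (\sum_(t in T) U_(t))%MM : P) = Y T.
Proof. by rewrite -mprodXE. Qed.

Lemma resid_kosd N w : resid N (kosd (yN N) w [set: 'I_n] : P) =1 fun=> 0.
Proof.
move=> m; rewrite /resid; case: forallP => // mN.
rewrite mcoeff_kosd big1 // => t; rewrite mnmE => /andP[_].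
by have := mN t; lia.
Qed.

Lemma resid_raise N c (q : P) :
  resid (N + c) (Y [set: 'I_n] ^+ c * q) =1 resid N q.
Proof.
have -> : Y [set: 'I_n] ^+ c = 'X_[(\sum_(t in [set: 'I_n]) U_(t)) *+ c].
  by rewrite -mpolyXn yprodX.
set a := (_ *+ c)%MM.
have aE i : a i = c.
  rewrite /a mulmnE mnm_sumE (bigD1 i) ?inE //= mnm1E eqxx.
  by rewrite big1 ?addn0 ?mul1n // => t /andP[_ /negbTE ti]; rewrite mnm1E ti.
move=> m; rewrite /resid mcoeffMX_if.
case: ifPn => [/forallP mN|mN]; last first.
  case: ifPn => // /forallP mN'; case/negP: mN; apply/forallP => i.
  by have := mN' i; lia.
case: ifPn => [/mnm_lepP am|am].
  have -> : [forall i, (m i < N)%N].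
    by apply/forallP => i; have := am i; have := mN i; rewrite aE mnmE; lia.
  by congr (_@_ _); apply/mnmP => i; rewrite !(mnmE, mnmBE) aE; lia.
case: ifPn => // /forallP mN'; case/negP: am; apply/mnm_lepP => i.
by have := mN' i; rewrite aE mnmE; lia.
Qed.

(** Vanishing residues mean membership in the ideal of the [y_s ^ N], tested
    monomial by monomial. *)
Lemma resid_supp N (q : P) : (resid N q =1 fun=> 0) ->
  forall a, q@_a != 0 -> exists s, (N <= a s)%N.
Proof.
move=> h a qa; apply/existsP; apply: contraT; rewrite negb_exists => /forallP aN.
have := h [multinom (N.-1 - a i)%N | i < n]; rewrite /resid.
have aN' i : (a i < N)%N by have := aN i; rewrite -ltnNge.
have -> : [forall i, ([multinom (N.-1 - a i)%N | i < n] i < N)%N].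
  by apply/forallP => i; rewrite mnmE; have := aN' i; lia.
have -> : [multinom (N.-1 - [multinom (N.-1 - a i) | i < n] i)%N | i < n] = a.
  by apply/mnmP => i; rewrite !mnmE; have := aN' i; lia.
by move=> q0; rewrite q0 eqxx in qa.
Qed.

Definition trunc k w : {set 'I_n} -> P^o := fun T => if #|T| == k then w T else 0.

Lemma kosd_trunc N k w T : #|T| = k.+1 -> kosd (yN N) (trunc k w) T = kosd (yN N) w T.
Proof.
move=> Tk; apply: eq_bigr => t tT; rewrite /trunc.
by move: Tk; rewrite (cardsD1 t T) tT add1n => -[->]; rewrite eqxx.
Qed.

(** Such a [q] is a combination of the [y_t ^ N]; this is [koszul_exact] for the
    cochain equal to [q] in top degree. *)
Lemma resid0_lift N (q : P) : (0 < n)%N -> (resid N q =1 fun=> 0) ->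
  exists w, [/\ forall T, #|T| != n.-1 -> w T = 0, kosd (yN N) w [set: 'I_n] = q &
    forall T a, (w T : P)@_a != 0 -> exists s k, s \notin T /\
      (w T : P)@_a = (-1) ^+ k * q@_(a + U_(s) *+ N)%MM].
Proof.
move=> n0 /resid_supp hq.
pose w0 T : P := if T == [set: 'I_n] then q else 0.
have [||w [dw hw]] := @koszul_exact n P0 N w0.
- move=> T a; rewrite /w0; case: (T =P _) => [_|_]; last by rewrite mcoeff0 eqxx.
  by move/hq => [s Ns]; exists s; rewrite Ns orbT.
- move=> T; rewrite /kosd big1 // => s sT; rewrite /w0.
  case: eqP => [TT|_]; last by rewrite !scaler0.
  by have := finset.in_setT s; rewrite -TT !inE eqxx.
exists (trunc n.-1 w); split.
- by move=> T /negbTE Tn; rewrite /trunc Tn.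
- by rewrite kosd_trunc ?dw /w0 ?eqxx // cardsT card_ord prednK.
move=> T a; rewrite /trunc; case: (#|T| =P _) => [Tn|_]; last by rewrite mcoeff0 eqxx.
move=> wa; have [s [k [sT e]]] := hw T a wa; exists s, k; split=> //.
move: e; rewrite /w0; case: (_ |: _ =P _) => // _; rewrite mcoeff0 mulr0 => e.
by rewrite e eqxx in wa.
Qed.

End CechNumerators.

(** * Cocycles of the hypersurface and their residues *)

Lemma mpoly_mulIr (R : idomainType) n (g a b : {mpoly R[n]}) :
  g != 0 -> a * g = b * g -> a = b.
Proof. by move=> g0; apply: (mulIf g0). Qed.

Lemma bipoly_cancel (K : fieldType) n (g a q k : {mpoly {mpoly K[n]}[n]}) :
  g != 0 -> a * (q * g) = - (g * k) -> a * q = - k.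
Proof.
move=> g0 e; apply: (mpoly_mulIr g0).
by rewrite -mulrA e -mulNr mulrC mulNr mulrN.
Qed.

Lemma residN n (R : comNzRingType) N (q : {mpoly R[n]}) m :
  resid N (- q) m = - resid N q m.
Proof. by rewrite /resid; case: ifP; rewrite ?oppr0 // mcoeffN. Qed.

Lemma qclass_eq0 (R : comNzRingType) (V : lmodType R) (W : submodClosed V) (v : V) :
  qclass W v = 0 <-> v \in W.
Proof.
have q0 : qclass W 0 = 0.
  by apply: (@addrI _ (qclass W 0)); rewrite -qclassD !addr0.
by rewrite -q0; split=> [/qclassP|vW]; last apply/qclassP; rewrite subr0.
Qed.

Section Representatives.
Variables (K : fieldType) (n : nat).
Local Notation P0 := {mpoly K[n]}.
Local Notation P := {mpoly {mpoly K[n]}[n]}.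
Variables (g : P) (M : lmodType P) (cl : P -> M).
Hypotheses (n_ge2 : (2 <= n)%N) (g0 : g != 0) (clP : presents g cl).
Local Notation yv := (@yvar K n).
Local Notation Y := (yprod yv).
Local Notation yN := (@ypow n {mpoly K[n]}).
Local Notation cocyc := (cocycle M yv n.-1).
Implicit Types (w b : {set 'I_n} -> P^o) (T : {set 'I_n}).

Let n_gt0 : (0 < n)%N. Proof. exact: ltnW. Qed.

Lemma card_setI_n : #|[set: 'I_n]| = n.-1.+1.
Proof. by rewrite cardsT card_ord prednK. Qed.

(** [q] represents the image of the class of [z] under the connecting map to the
    top local cohomology of [P]. *)
Definition represents N w (q : P) (z : cocyc) : Prop :=
  [/\ forall T, #|T| != n.-1 -> w T = 0, val z = cochain_of cl N w &
      kosd (yN N) w [set: 'I_n] = q * g].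

Lemma represents_raise N c w q z : represents N w q z ->
  represents (N + c) (fun T => Y T ^+ c * w T : P^o) (Y [set: 'I_n] ^+ c * q) z.
Proof.
case=> w0 zw dw; split; last by rewrite kosd_raise dw mulrA.
  by move=> T /w0 ->; rewrite mulr0.
by rewrite zw; apply: functional_extensionality_dep => T; rewrite /cochain_of -(clf_raise clP _ N c).
Qed.

Lemma represents_common N c w q z (v : 'X_{1..n} -> P0) :
  represents N w q z -> v =1 resid N q ->
  exists w' q', represents (N + c) w' q' z /\ v =1 resid (N + c) q'.
Proof.
move=> zr vr; do 2 eexists; split; first exact: represents_raise zr.
by move=> m; rewrite resid_raise vr.
Qed.

Lemma represents_linear N w q z w' q' z' a : represents N w q z ->
  represents N w' q' z' ->
  represents N (fun T => a * w T + w' T : P^o) (a * q + q') (a *: z + z').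
Proof.
case=> w0 zw dw [w0' zw' dw']; split.
- by move=> T Tn; rewrite w0 // w0' // mulr0 addr0.
- have -> : val (a *: z + z') = a *: val z + val z' by [].
  rewrite zw zw'; apply: functional_extensionality_dep => T.
  by rewrite /cochain_of (clfD clP) -(clfZ clP).
rewrite (kosdD (yN N) (fun T => a *: w T)) dw' mulrDl -mulrA -dw; congr (_ + _).
have := kosd_linear (GRing.scale a : {linear P^o -> P^o}) (yN N) w [set: 'I_n].
exact.
Qed.

Lemma represents_exists N w q : (forall T, #|T| != n.-1 -> w T = 0) ->
  kosd (yN N) w [set: 'I_n] = q * g -> exists z, represents N w q z.
Proof.
move=> w0 dw.
have cw : cochain_of cl N w \in cocycle_pred n.-1.
  apply/asboolP; split=> [T /w0 wT|]; first by rewrite /cochain_of wT (clf0 clP).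
  rewrite (cechd_cochain_of clP); apply: functional_extensionality_dep => T.
  have [/eqP Tn|Tn] := boolP (#|T| == n.-1.+1); last first.
    by rewrite /cochain_of (kosd_supp _ w0 Tn) (clf0 clP).
  have -> : T = [set: 'I_n].
    by apply/eqP; rewrite eqEcard finset.subsetT card_setI_n Tn leqnn.
  rewrite /cochain_of dw -[RHS](clf0 clP N _).
  by apply: (@clf_eq1 K n g M cl clP _ _ _ _ (q)); rewrite subr0.
by exists (exist (fun c : cech M yv => is_true (c \in cocycle_pred n.-1)) _ cw).
Qed.

Lemma cech_common_power (c : cech M yv) :
  exists N w, c = cochain_of cl N w.
Proof.
have H T : exists Np : nat * P, c T = clf cl Np.1 T Np.2.
  by have [N [p e]] := clf_surj clP (c T); exists (N, p).
have [f Hf] := fin_all_exists H.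
pose N := (\max_T (f T).1)%N.
exists N, (fun T => Y T ^+ (N - (f T).1) * (f T).2).
apply: functional_extensionality_dep => T.
rewrite Hf /cochain_of -(clf_raise clP _ _ (N - (f T).1)) subnKC //.
exact: (leq_bigmax T).
Qed.

(** A primitive of [z] lifts to numerators [b] in [P], so [w] is [kosd b] up to a
    multiple [g k] once the exponents agree.  As [kosd] squares to zero, [q] is a
    boundary up to sign, and boundaries have no residue. *)
Lemma represents_coboundary N w q z : represents N w q z ->
  z \in coboundary_pred M yv n.-1 -> resid N q =1 fun=> 0.
Proof.
case=> w0 zw dw /asboolP[beta [_]]; rewrite zw.
have [N' [b ->]] := cech_common_power beta; rewrite (cechd_cochain_of clP) => eb.
have H T : exists ck : nat * P, Y T ^+ (ck.1 + N) * kosd (yN N') b T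
    - Y T ^+ (ck.1 + N') * w T = ck.2 * g.
  have := congr1 (fun c : cech M yv => c T) eb.
  by move=> /(clf_eq clP)[c [k e]]; exists (c, k).
have [f Hf] := fin_all_exists H.
pose c := (\max_T (f T).1)%N.
pose k T : P^o := Y T ^+ (c - (f T).1) * (f T).2.
have Hk T : Y T ^+ (c + N') * w T = kosd (yN (N + N' + c)) (fun T => Y T ^+ (c + N) * b T : P^o) T
     - g * k T.
  have -> : (N + N' + c = N' + (c + N))%N by lia.
  rewrite kosd_raise /k [g * _]mulrC -[_ * _ * g]mulrA -Hf mulrBr !mulrA -!exprD.
  have fc : ((f T).1 <= c)%N by apply: (leq_bigmax T).
  by rewrite !addnA subnK // subKr.
pose kk : P := kosd (yN (N + N' + c)) k [set: 'I_n].
have eN : (N + (c + N') = N + N' + c)%N by lia.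
have ekk : Y [set: 'I_n] ^+ (c + N') * (q * g) = - (g * kk).
  rewrite -dw -kosd_raise (@eq_kosd n P P^o _ _ (fun T => kosd (yN (N + N' + c))
       (fun T => Y T ^+ (c + N) * b T : P^o) T - g * k T)) // eN.
  rewrite kosdB kosdK sub0r; congr (- _).
  exact: (kosd_linear (GRing.scale g : {linear P^o -> P^o})).
have e : Y [set: 'I_n] ^+ (c + N') * q = - kk := bipoly_cancel g0 ekk.
by move=> m; rewrite -(resid_raise N (c + N')) e residN eN /kk resid_kosd oppr0.
Qed.

(** Without residues [q] is [kosd h] in top degree, so [w - g h] is a cocycle of
    [P] that represents the same cochain of the quotient; the Koszul complex of
    [P] is exact there. *)
Lemma coboundary_represents N w q z : represents N w q z ->
  resid N q =1 (fun=> 0) -> z \in coboundary_pred M yv n.-1.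
Proof.
case=> w0 zw dw /(resid0_lift n_gt0)[h [h0 dh _]].
pose w' T : P^o := w T - g * h T.
have w'0 T : #|T| != n.-1 -> w' T = 0.
  by move=> Tn; rewrite /w' w0 // h0 // mulr0 subr0.
have dw' : kosd (yN N) w' =1 fun=> 0.
  move=> T; have [/eqP Tn|Tn] := boolP (#|T| == n.-1.+1); last first.
    exact: kosd_supp w'0 Tn.
  have -> : T = [set: 'I_n].
    by apply/eqP; rewrite eqEcard finset.subsetT card_setI_n Tn leqnn.
  rewrite kosdB dw; have /= -> := kosd_linear (GRing.scale g : {linear P^o -> P^o}) (yN N) h [set: 'I_n].
  by rewrite dh [_ *: _]mulrC subrr.
have [|b [db _]] := koszul_exact _ dw'.
  move=> T a; have [/eqP Tn _|Tn] := boolP (#|T| == n.-1); last first.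
    by rewrite w'0 // mcoeff0 eqxx.
  have /set0Pn[s] : ~: T != finset.set0.
    rewrite -card_gt0 cardsCs finset.setCK card_ord Tn subn_gt0.
    by rewrite prednK.
  by rewrite inE => sT; exists s; rewrite sT.
apply/asboolP; exists (cochain_of cl N (trunc n.-2 b)); split.
  move=> T Tn; rewrite /cochain_of /trunc ifN ?(clf0 clP) //.
  by apply: contra Tn => /eqP ->; rewrite prednK // -ltnS prednK.
rewrite (cechd_cochain_of clP) zw; apply: functional_extensionality_dep => T.
rewrite /cochain_of; have [/eqP Tn|Tn] := boolP (#|T| == n.-1); last first.
  rewrite w0 // (@kosd_supp _ _ _ n.-2) //.
    by move=> T' /negbTE T'n; rewrite /trunc T'n.
  by rewrite prednK // -ltnS prednK.
rewrite kosd_trunc ?db; last by rewrite prednK // -ltnS prednK.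
by apply: (@clf_eq1 K n g M cl clP _ _ _ _ (- h T)); rewrite /w'; ring.
Qed.

End Representatives.

(** * Degrees of Cech numerators *)

Lemma mpoly_expf_neq0 (R : idomainType) n (p : {mpoly R[n]}) k :
  p != 0 -> p ^+ k != 0.
Proof. exact: expf_neq0. Qed.

Lemma mnm_le_mdeg n (m : 'X_{1..n}) k : (m k <= mdeg m)%N.
Proof. by rewrite mdegE (bigD1 k) //= leq_addr. Qed.

Section Degrees.
Variables (K : fieldType) (n : nat).
Local Notation P0 := {mpoly K[n]}.
Local Notation P := {mpoly {mpoly K[n]}[n]}.
Local Notation yv := (@yvar K n).
Local Notation Y := (yprod yv).
Local Notation yN := (@ypow n {mpoly K[n]}).

Definition ydeg (e : int) (p : P) : Prop := {in msupp p, forall a, (mdeg a)%:Z = e}.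

Lemma ydegM e k (p h : P) : ydeg e p -> h \is k.-homog -> ydeg (e + k%:Z) (h * p).
Proof.
move=> hp hh a /msuppM_le /allpairsP[[b c] /= [hb hc ->]].
by rewrite mdegD PoszD (hp c hc) (dhomog_mf hh hb) addrC.
Qed.

Lemma dhomog_yprod (T : {set 'I_n}) k : Y T ^+ k \is (#|T| * k).-homog.
Proof.
apply: dhomogMn; rewrite -yprodX dhomogX /= mdeg_sum.
by apply/eqP; rewrite -sum1_card; apply: eq_bigr => t _; rewrite mdeg1.
Qed.

Lemma ydeg_kosd e N (w : {set 'I_n} -> P^o) :
  (forall T : {set 'I_n}, #|T| = n.-1 -> ydeg e (w T)) -> ydeg (e + N%:Z) (kosd (yN N) w [set: 'I_n]).
Proof.
move=> hw a; rewrite mcoeff_msupp mcoeff_kosd => sum_neq0.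
have [t Na wa] : exists2 t, (N <= a t)%N &
    (w ([set: 'I_n] :\ t) : P)@_(a - U_(t) *+ N)%MM != 0.
  apply: contrapT => nex; move/eqP: sum_neq0; apply.
  apply: big1 => t /andP[_ Na]; apply/eqP; apply: contraT => h; case: nex.
  by exists t => //; apply: contraNneq h => ->; rewrite mulr0.
have Ta : #|[set: 'I_n] :\ t| = n.-1.
  have := cardsD1 t [set: 'I_n]; rewrite cardsT card_ord finset.in_setT add1n.
  by move=> e1; rewrite [in RHS]e1.
have := hw _ Ta (a - U_(t) *+ N)%MM; rewrite mcoeff_msupp => /(_ wa) <-.
rewrite -PoszD; congr Posz.
have le_a : (U_(t) *+ N <= a)%MM.
  apply/mnm_lepP => i; rewrite mulmnE mnm1E.
  by case: eqP => [<-|] //=; rewrite mul1n.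
by rewrite -{1}(submK le_a) mdegD mdegMn mdeg1 mul1n.
Qed.

Lemma mdeg_compl N (m : 'X_{1..n}) : (forall i, (m i < N)%N) ->
  (mdeg [multinom (N.-1 - m i)%N | i < n] + mdeg m = n * N.-1)%N.
Proof.
move=> mN; rewrite !mdegE -big_split /= -[n in RHS]card_ord -sum_nat_const.
by apply: eq_bigr => i _; rewrite mnmE subnK //; have := mN i; lia.
Qed.

End Degrees.

(** * Local cohomology of the hypersurface as the kernel of contraction *)

Section HypersurfaceCohomology.
Variables (K : fieldType) (n : nat).
Hypotheses (charK : [pchar K] =i pred0) (n_ge2 : (2 <= n)%N).
Variable lam : 'rV[K]_n.
Hypothesis lam0 : forall i, lam 0 i != 0.
Variables (r d : nat).
Local Notation P0 := {mpoly K[n]}.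
Local Notation P := {mpoly {mpoly K[n]}[n]}.
Local Notation yv := (@yvar K n).
Local Notation Y := (yprod yv).
Local Notation yN := (@ypow n {mpoly K[n]}).
Local Notation g := (flam lam ^+ r).
Local Notation M := (hypersurface g).
Local Notation j := (- (n + d)%:Z).
Local Notation crows := (@contr_rows K n lam r d).

Definition hcl (p : P) : M := @qclass P P^o (principal g) p.

Lemma hcl_presents : presents g hcl.
Proof.
split=> [p p'|a p|p p'|m].
- exact: qclassD.
- exact: qscaleE.
- split=> [/qclassP/asboolP //|h].
  by apply/qclassP/asboolP.
by have [p ->] := @qclass_surj P P^o (principal g) m; exists p.
Qed.

Lemma flam_exp_neq0 : g != 0.
Proof.
apply: mpoly_expf_neq0; have i : 'I_n by apply: (Ordinal (ltnW n_ge2)).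
apply/eqP => /(congr1 (mcoeff U_(i))).
rewrite mcoeff0 raddf_sum (bigD1 i) //= mcoeffZ mcoeffXU eqxx mulr1.
rewrite big1 ?addr0 => [|k ki]; last by rewrite mcoeffZ mcoeffXU (negbTE ki) mulr0.
move/(congr1 (mcoeff U_(i))); rewrite mcoeff0 mcoeffZ mcoeffXU eqxx mulr1.
by move/eqP; rewrite (negbTE (lam0 i)).
Qed.

(** The graph of the isomorphism from the kernel of contraction to
    [H^(n-1)(P/g)_j]. *)
Definition lc_rel (v : 'rV[P0]_(nmon n (d + r)))
    (h : gambient (lc_part (@hypersurface_comp K n g) n.-1 j)) : Prop :=
  exists N w q (z : cocycle M yv n.-1),
    [/\ represents g hcl N w q z, h = qclass (coboundary_pred M yv n.-1) z &
        row_fun v =1 resid N q].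

Lemma lc_rel_linear c v v' h h' : lc_rel v h -> lc_rel v' h' ->
  lc_rel (c *: v + v') (c *: h + h').
Proof.
move=> [N [w [q [z [rz -> vq]]]]] [N' [w' [q' [z' [rz' -> vq']]]]].
have [w1 [q1 [rz1 vq1]]] := represents_common hcl_presents N' rz vq.
have [w2 [q2 [rz2 vq2]]] := represents_common hcl_presents N rz' vq'.
rewrite addnC in rz2 vq2.
have rz3 := represents_linear hcl_presents (c%:MP : P) rz1 rz2.
do 4 eexists; split; first exact: rz3.
  by rewrite qclassD -qscaleE.
by move=> m; rewrite row_fun_linear vq1 vq2 -resid_linear mul_mpolyC.
Qed.

Lemma lc_rel_eq0 v h : lc_rel v h -> h = 0 <-> v = 0.
Proof.
move=> [N [w [q [z [rz -> vq]]]]]; split=> [/qclass_eq0 zb|v0].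
  rewrite -[v]fun_rowK; apply/rowP => i; rewrite !mxE vq.
  exact: (represents_coboundary n_ge2 flam_exp_neq0 hcl_presents rz zb).
apply/qclass_eq0/(coboundary_represents n_ge2 hcl_presents rz) => m.
by rewrite -vq v0 /row_fun big1 // => i _; rewrite mxE if_same.
Qed.

Lemma lc_rel0 : lc_rel 0 0.
Proof.
have [||z rz] := @represents_exists K n g M hcl n_ge2 hcl_presents 0 (fun=> 0) 0.
- by [].
- by rewrite mul0r; apply: kosd0.
have h0 : lc_rel 0 (qclass (coboundary_pred M yv n.-1) z).
  exists 0%N, (fun=> 0), 0, z; split=> // m.
  by rewrite resid0 /row_fun big1 // => i _; rewrite mxE if_same.
by have [_ e0] := lc_rel_eq0 h0; rewrite -(e0 erefl).
Qed.

(** The exponent [N = d + r + 1] is the least for which every monomial of degree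
    [d + r] occurs in a residue.  The numerators of the cocycle have coefficients
    among those of [q g], which yields their bidegree. *)
Lemma lc_rel_homog v : crows v = 0 -> rhom d.+1 v ->
  exists2 h, lc_comp (@hypersurface_comp K n g) (d.+1 + r)%N%:Z j h & lc_rel v h.
Proof.
move=> vZ hv; pose N := (d + r).+1.
have monN i k : (@mon n (d + r) i k < N)%N.
  by rewrite ltnS; have := mnm_le_mdeg (mon i) k; rewrite mdeg_mon.
pose q : P := \sum_i v 0 i *: 'X_[[multinom (N.-1 - mon i k)%N | k < n]].
have qE a : q@_a = \sum_i if [multinom (N.-1 - mon i k)%N | k < n] == a then v 0 i else 0.
  rewrite raddf_sum; apply: eq_bigr => i _ /=; rewrite mcoeffZ mcoeffX.
  by case: eqP => _; rewrite ?mulr1 ?mulr0.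
have vq : row_fun v =1 resid N q.
  move=> m; rewrite /resid; case: ifPn => [/forallP mN|mN].
    rewrite qE; apply: eq_bigr => i _; congr (if _ then _ else _).
    apply/eqP/eqP => [->//|/mnmP e]; apply/mnmP => k.
    by have := e k; rewrite !mnmE; have := monN i k; have := mN k; lia.
  apply: row_fun_out; apply: contra mN => /eqP md; apply/forallP => k.
  by rewrite ltnS -md mnm_le_mdeg.
pose D := (n * (d + r) - (d + r))%N.
have hq : q \is D.-homog.
  apply: rpred_sum => i _; apply: dhomogZ; rewrite dhomogX /=.
  by have := mdeg_compl (monN i); rewrite mdeg_mon /D => <-; rewrite addnK.
have xq : xdhomog d.+1 q.
  by move=> a; rewrite qE; apply: rpred_sum => i _; case: ifP => _; [apply: hv|apply: dhomog0].
have hqg : q * g \is (D + r).-homog by apply: dhomogM => //; apply: flam_exp_dhomog.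
have xqg : xdhomog (d.+1 + r) (q * g) by apply: xdhomogM => //; apply: flam_exp_xdhomog.
have rqg : resid N (q * g) =1 fun=> 0.
  move=> m; rewrite mulrC residM -(eq_contr _ vq) -row_fun_contr vZ.
  by rewrite /row_fun big1 // => i _; rewrite mxE if_same.
have [w [w0 dw hw]] := resid0_lift (ltnW n_ge2) rqg.
have [z rz] := represents_exists n_ge2 hcl_presents w0 dw.
exists (qclass (coboundary_pred M yv n.-1) z); last by exists N, w, q, z.
exists z; split=> // S; exists (hcl (w S)), N; split; last first.
  by case: rz => _ ->.
exists (w S) => // a; rewrite mcoeff_msupp => wa.
have [s [k [sS e]]] := hw S a wa.
have Sn : #|S| = n.-1 by apply/eqP; apply: contraNT wa => /w0 ->; rewrite mcoeff0.
split.
  have : mdeg (a + U_(s) *+ N)%MM = (D + r)%N.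
    apply: (dhomog_mf hqg); rewrite mcoeff_msupp.
    by apply: contraNneq wa => e0; rewrite e e0 mulr0.
  rewrite mdegD mdegMn mdeg1 mul1n Sn /D /N => eD.
  have en : n = n.-1.+1 by rewrite prednK // ltnW.
  have e1 : (n * (d + r) = (d + r) + n.-1 * (d + r))%N by rewrite {1}en mulSn.
  have e2 : ((d + r).+1 * n.-1 = n.-1 + n.-1 * (d + r))%N by rewrite mulSn [((d + r) * _)%N]mulnC.
  move: eD; rewrite e1 e2 /= addKn; move: (mdeg a) en => x en.
  by move: (n.-1 * (d + r))%N => y eD; lia.
move=> m; rewrite e -signr_odd => hm.
suff : (-1) ^+ odd k * (q * g)@_(a + U_(s) *+ N) \is (d.+1 + r).-homog.
  by move=> h; rewrite (dhomog_mf h hm).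
by case: odd; rewrite ?expr1 ?mulN1r ?rpredN ?expr0 ?mul1r.
Qed.

(** Only the [y]-degree of the cocycle matters: it makes the equation
    [kosd w = q' g] homogeneous in [y], so [q'] may be replaced by its component
    [q] of the right degree, whose residues sit on monomials of degree
    [d + r]. *)
Lemma lc_rel_onto i h : lc_comp (@hypersurface_comp K n g) i j h ->
  exists2 v, crows v = 0 & lc_rel v h.
Proof.
move=> [z [Hz hz]].
have H (S : {set 'I_n}) : exists pa : P * nat,
    ydeg (j + (pa.2 * #|S|)%N%:Z) pa.1 /\ val z S = clf hcl pa.2 S pa.1.
  have [m [a [[p hp ->] zS]]] := Hz S; exists (p, a); split=> //.
  by move=> b /hp[].
have [f Hf] := fin_all_exists H.
pose N0 := (\max_(S : {set 'I_n}) (f S).2)%N.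
have [z0 dz] : cochain n.-1 (val z) /\ cechd (val z) = 0.
  by have /asboolP := valP z.
pose w0 (S : {set 'I_n}) : P^o := if #|S| == n.-1 then Y S ^+ (N0 - (f S).2) * (f S).1 else 0.
have zE : val z = cochain_of hcl N0 w0.
  apply: functional_extensionality_dep => S; rewrite /cochain_of /w0.
  case: ifPn => Sn; last by rewrite (clf0 hcl_presents) z0.
  rewrite (Hf S).2 -(clf_raise hcl_presents _ _ (N0 - (f S).2)) subnKC //.
  exact: (leq_bigmax S).
have [c [k ek]] : exists c k, Y [set: 'I_n] ^+ (c + N0) * kosd (yN N0) w0 [set: 'I_n]
    = k * g.
  have := congr1 (fun c : cech M yv => c [set: 'I_n]) dz.
  rewrite zE (cechd_cochain_of hcl_presents) => e.
  have : clf hcl N0 [set: 'I_n] (kosd (yN N0) w0 [set: 'I_n]) = clf hcl N0 [set: 'I_n] 0.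
    by rewrite (clf0 hcl_presents) -[RHS]e.
  by move=> /(clf_eq hcl_presents)[c [k]]; rewrite mulr0 subr0; exists c, k.
(* The summand (d + r).+1 makes N exceed every exponent of a monomial of
   degree d + r, so that the degree D below is not truncated. *)
pose c' := (c + N0 + (d + r).+1)%N; pose N := (N0 + c')%N.
pose w (S : {set 'I_n}) : P^o := Y S ^+ c' * w0 S.
have dw : kosd (yN N) w [set: 'I_n] = (Y [set: 'I_n] ^+ (d + r).+1 * k) * g.
  by rewrite /w kosd_raise /c' [(c + N0 + _)%N]addnC exprD -!mulrA ek.
have hw (S : {set 'I_n}) : #|S| = n.-1 -> ydeg (j + (N * n.-1)%N%:Z) (w S).
  move=> Sn; rewrite /w /w0 Sn eqxx mulrA -exprD.
  have := ydegM (Hf S).1 (dhomog_yprod K S (c' + (N0 - (f S).2))).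
  have fS : ((f S).2 <= N0)%N by apply: (leq_bigmax S).
  rewrite -addrA -PoszD Sn mulnC -mulnDr.
  rewrite (_ : (f S).2 + _ = N)%N 1?mulnC // /N; lia.
have hdw := ydeg_kosd hw (N := N).
have NE : (d + r < N)%N by rewrite /N /c'; lia.
have nN : (n + d + r <= n * N)%N.
  have := leq_mul (leqnn n) NE; rewrite mulnS; move: n_ge2.
  have : (d + r <= n * (d + r))%N by rewrite leq_pmull // ltnW.
  by move: (n * (d + r))%N (n * N)%N => x y; lia.
pose D := (n * N - (n + d + r))%N.
have hD : kosd (yN N) w [set: 'I_n] \is (D + r).-homog.
  apply/dhomogP => a /hdw /= ea; apply/eqP; rewrite -eqz_nat ea; apply/eqP.
  have eN : (n * N = N * n.-1 + N)%N.
    by rewrite -mulnSr prednK 1?mulnC // ltnW.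
  move: nN; rewrite /D eN; move: (N * n.-1)%N => x; lia.
pose q := pihomog mdeg D (Y [set: 'I_n] ^+ (d + r).+1 * k).
have dwq : kosd (yN N) w [set: 'I_n] = q * g.
  rewrite -(pihomogM _ _ (flam_exp_dhomog lam r)) -dw; apply/esym.
  exact: pihomog_dE.
have rz : represents g hcl N w q z.
  split=> //; first by move=> S /negbTE Sn; rewrite /w /w0 Sn mulr0.
  rewrite zE; apply: functional_extensionality_dep => S.
  by rewrite /cochain_of -(clf_raise hcl_presents _ _ c').
have supp m : mdeg m != (d + r)%N -> resid N q m = 0.
  rewrite /resid; case: ifP => // /forallP mN md.
  apply: (dhomog_nemf_coeff (pihomogP mdeg D _)); apply: contra md => /eqP /= mD.
  have := mdeg_compl mN; rewrite mD /D; move: nN.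
  have -> : (n * N = n * N.-1 + n)%N by rewrite -mulnSr prednK // (leq_trans _ NE).
  by move: (n * N.-1)%N => x; lia.
exists (fun_row (d + r) (resid N q)).
  apply/rowP => l; rewrite !mxE (eq_contr _ (row_funK supp)) -residM mulrC -dwq.
  exact: resid_kosd.
exists N, w, q, z; split=> //; exact: row_funK.
Qed.

End HypersurfaceCohomology.

(** * Linearity of the resolutions *)

Theorem corollary4p5 (K : fieldType) (n r : nat)
    (charK : [pchar K] =i pred0) (n_ge2 : (2 <= n)%N) (r_ge1 : (1 <= r)%N) :
  exists V : set 'rV[K]_n,
    [/\ zariski_open V, (V !=set0)%classic &
     forall lam : 'rV[K]_n, V lam -> forall j : int, j <= - n%:Z ->
       has_linear_resolution
         (lc_part (@hypersurface_comp K n (flam lam ^+ r)) n.-1 j)].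
Proof.
exists [set lam : 'rV[K]_n | forall i, lam 0 i != 0]%classic; split.
- exists [set \prod_i 'X_i]%classic => v; split=> [v0|[p -> +] i].
    exists (\prod_i 'X_i) => //; rewrite rmorph_prod; apply/prodf_neq0 => i _.
    by rewrite /= mevalXU.
  by rewrite rmorph_prod => /prodf_neq0 /(_ i isT); rewrite /= mevalXU.
- by exists (const_mx 1) => i; rewrite mxE oner_eq0.
move=> lam lam0 j jn; pose d := `|(- j - n%:Z)%R|%N.
have -> : j = - (n + d)%:Z by rewrite /d; lia.
apply: (linear_resolution_criterion (d := (d.+1 + r)%N%:Z)
  (contr_kernel_linear charK lam0 r d) (lc_rel0 n_ge2 lam0 r d)).
- exact: lc_rel_linear.
- exact: lc_rel_eq0.
- exact: lc_rel_homog.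
- exact: lc_rel_onto.
Qed.
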